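(* Let $v_3=1$ and for $m\ge 4$ define \[ v_m=\frac12\sum_{i=1}^{m-3}\frac{i(m-i-2)}{m-1}\binom{m-4}{i-1}\binom{m}{i+1}v_{i+2}v_{m-i}. \] Let $a(0)=1$ and for $n\ge 1$ define \[ a(n)=\frac12\sum_{i=1}^{n}\frac{i(n-i+1)}{n+2}\binom{n-1}{i-1}\binom{n+3}{i+1}a(i-1)a(n-i). \] Then for all $n\ge 1$, $a(n)=v_{n+3}=|\mathrm{BSD}(c^n,n)|$, i.e. $a(n)$ equals the number of ways to partition the rectangle with $n$ rows and $2n$ columns (equivalently, by transposition, with $2n$ rows and $n$ columns) into border strips each consisting of $n$ boxes.
   Context: A border strip is a set of boxes of a diagram forming a connected skew shape that contains no $2\times 2$ square. $\mathrm{BSD}(c^n,n)$ denotes the set of partitions of the set of boxes of the $n\times 2n$ rectangle (this rectangle is the simple diagram $(c^n,n)$, obtained from the $n\times n$ square by adjoining $n$ columns of height $n$ on the left) into border strips of exactly $n$ boxes each. (The numbers $v_m$ are the numbers appearing in Zograf's formula $\mathrm{Vol}_{WP}(M_{0,m})=\pi^{2(m-3)}v_m/(m!(m-3)!)$ for the Weil--Petersson volume of the moduli space of the $m$-punctured Riemann sphere.) *)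

(* Defs.v *)
From mathcomp Require Import all_boot all_order all_algebra.
Set Implicit Arguments.
Unset Strict Implicit.
Unset Printing Implicit Defensive.

(* The box (i, j) lies in row i and column j, both numbered from 0, rows
   downwards and columns rightwards. *)
Notation box r c := ('I_r * 'I_c)%type.

(* Young diagrams contained in the r x c rectangle. *)
Definition young_diagram r c (D : {set box r c}) : bool :=
  [forall x : box r c, forall y : box r c,
     [&& y \in D, x.1 <= y.1 & x.2 <= y.2] ==> (x \in D)].

(* Restricting the two diagrams to the rectangle loses no generality: a skew
   shape S = lam / mu contained in the rectangle is also the difference of the
   intersections of lam and mu with it. *)
Definition skew_shape r c (S : {set box r c}) : bool :=
  [exists lam : {set box r c}, exists mu : {set box r c},
     [&& young_diagram lam, young_diagram mu, mu \subset lam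
       & S == lam :\: mu]].

Definition adjacent r c (x y : box r c) : bool :=
  ((x.1 == y.1) && ((x.2.+1 == y.2 :> nat) || (y.2.+1 == x.2 :> nat)))
  || ((x.2 == y.2) && ((x.1.+1 == y.1 :> nat) || (y.1.+1 == x.1 :> nat))).

Definition connected_boxes r c (S : {set box r c}) : bool :=
  [forall x in S, forall y in S,
     connect [rel u v | [&& u \in S, v \in S & adjacent u v]] x y].

(* x and y are the upper left and lower right corners of the square. *)
Definition has_2x2_square r c (S : {set box r c}) : bool :=
  [exists x : box r c, exists y : box r c,
     [&& y.1 == x.1.+1 :> nat, y.2 == x.2.+1 :> nat,
         x \in S, (x.1, y.2) \in S, (y.1, x.2) \in S & y \in S]].

Definition border_strip r c (S : {set box r c}) : bool :=
  [&& S != set0, skew_shape S, connected_boxes S & ~~ has_2x2_square S].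

(* Set partitions of the boxes of the r x c rectangle into border strips of
   exactly k boxes each. *)
Definition BSD r c k : {set {set {set box r c}}} :=
  [set P : {set {set box r c}} | partition P [set: box r c]
     & [forall S in P, border_strip S && (#|S| == k)]].

(* Main.v *)
(** Number the diagonals of the rectangle from its lower left corner.  A border
strip with n boxes meets n consecutive diagonals in one box each, and counting
boxes diagonal by diagonal shows that exactly one strip starts on each of the
diagonals 0, ..., 2n-1.  Passing from a diagonal to the next one, the strip that
ends is deleted, a new one is inserted at or below its position, and all the
others keep their order; hence a decomposition is encoded by the positions q_d
at which its strips start.

From the diagonal n-1 on, only the heights of the strips still to be deleted
matter, and the number w(c_1, ..., c_k) of continuations, summed over all orders
of deletion of marks at heights c_1 < ... < c_k, satisfies
  w(c) = sum_r sum_(p < c_r) w(c without c_r, with c_i + 1 for p < c_i < c_r),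
and the decompositions are counted by w(1, ..., n).  Let
y = sum a(m) x^(m+1) / ((m+1)! m!) and phi = y'.  Zograf's recursion integrates
to y = phi (x - x y + int y), hence y phi' = x phi^3.  This equation implies that
k! (D_{c_k} ... D_{c_1} 1)(0), where D_c = phi^-1 d/dx + c phi' / phi^2, satisfies
the recursion of w.  For c = (1, ..., n) the product telescopes and gives
n! phi^(n)(0) = a(n). *)
Require Import Defs.
From mathcomp Require Import all_boot all_order all_algebra.
From mathcomp Require Import zify ring.
Set Implicit Arguments.
Unset Strict Implicit.
Unset Printing Implicit Defensive.
Import Order.TTheory GRing.Theory Num.Theory.
Local Open Scope ring_scope.

(** * The operators D_c *)

Section Flow.
Variable y : {poly rat}.
Local Notation phi := (y^`()).

(* phi^(2k) D_{c_k} ... D_{c_1} 1 for s = [:: c_k; ...; c_1]: the power of phi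
   clears the denominators.  flowM and flowE are the sums of flowS_lift_sum and
   flowE_moves, scaled by phi^(2k) and phi^(2k-2). *)
Fixpoint flowS (s : seq nat) : {poly rat} :=
  if s is c :: s' then
    phi * (flowS s')^`() + (c%:R - (size s').*2%:R) * phi^`() * flowS s'
  else 1.

Fixpoint flowM (s : seq nat) : {poly rat} :=
  if s is c :: s' then
    c%:R * phi^`() * flowS s' + phi * (flowM s')^`()
    + (c%:R + 1 - (size s').*2%:R) * phi^`() * flowM s'
  else 0.

Fixpoint flowE (s : seq nat) : {poly rat} :=
  if s is c :: s' then
    phi * (flowE s')^`() + (c%:R + 2%:R - (size s').*2%:R) * phi^`() * flowE s'
    + c%:R * flowS s' + flowM s'
  else 0.

Definition ode_defect : {poly rat} := y * phi^`() - 'X * phi ^+ 3.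

(* In terms of the undivided series S, M, E this is, up to a power of phi,
   E - (k S + y dS/dy - x phi M). *)
Definition flow_err (s : seq nat) : {poly rat} :=
  phi ^+ 3 * flowE s - ((size s)%:R * phi * flowS s + y * (flowS s)^`()
    - (size s).*2%:R * 'X * phi ^+ 2 * flowS s - 'X * phi ^+ 2 * flowM s).

Lemma deriv_natr (R : nzRingType) n : (n%:R : {poly R})^`() = 0.
Proof. by rewrite -polyC_natr derivC. Qed.

(** The new error is a first order differential operator applied to the old one, plus multiples of
    the defect and of its derivative; an exact solution would thus keep the error at 0. *)
Lemma flow_err_cons c s :
  flow_err (c :: s) =
    phi * (flow_err s)^`() + (c%:R - (size s).*2%:R - 1) * phi^`() * flow_err s
    - (c%:R - (size s).*2%:R) * flowS s * ode_defect^`()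
    - 2%:R * (flowS s)^`() * ode_defect.
Proof.
rewrite /flow_err /ode_defect /=.
move: (flowS s) (flowM s) (flowE s) (size s) => S M E k.
rewrite !(derivE, derivM, derivD, derivB, derivXn, deriv_natr) /=.
rewrite -!mul2n !natrM -!(natr1 k) !mulrDr.
rewrite !expr2 !exprS !expr0.
move: (k%:R : {poly rat}) (c%:R : {poly rat}) => K C.
ring.
Qed.

End Flow.

(** * Removing one mark and lifting others *)

Section Moves.
Variable V : zmodType.
Implicit Types (F G : seq nat -> V) (L : V -> V) (s : seq nat).

Definition lift_above p s := [seq x + (p < x) | x <- s]%N.

(** The right side of the recursion of w for a decreasing list: when [c] is removed, only the
    smaller marks, which come after it, can be lifted. *)
Fixpoint moves F s : V :=
  if s is c :: s' then
    \sum_(p < c) F (lift_above p s') + moves (fun s1 => F (c :: s1)) s'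
  else 0.

Lemma size_lift_above p s : size (lift_above p s) = size s.
Proof. exact: size_map. Qed.

(** Only lists one shorter than [s] occur, so [L] may involve that length. *)
Lemma moves_additive F G L s :
    L 0 = 0 -> {morph L : u v / u + v} ->
    (forall s1, (size s1).+1 = size s -> G s1 = L (F s1)) ->
  moves G s = L (moves F s).
Proof.
move=> L0 LD; elim: s F G => [|c s IHs] F G FG //=.
rewrite LD (big_morph L LD L0); congr (_ + _).
  by apply: eq_bigr => p _; apply: FG; rewrite size_lift_above.
by apply: IHs => s1 s1s; apply: FG; rewrite /= s1s.
Qed.

(** New position of the strip at [x] when the strip at [p] is deleted and another is inserted at
    [q <= p]: those from [q] up to [p] make room. *)
Definition shift (q p x : nat) : nat := x + (q <= x < p).

(** Heights are positions plus one, so [q <= x] reads [q < x.+1] and the insertion position becomes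
    the threshold of [lift_above]. Entries before [p] exceed it and are not shifted. *)
Lemma moves_sorted F s : sorted gtn s ->
  \sum_(p <- s) \sum_(q < p.+1) F [seq (shift q p x).+1 | x <- rem p s]
    = moves F [seq x.+1 | x <- s].
Proof.
elim: s F => [|p0 s IHs] F /=; first by rewrite big_nil.
rewrite path_sortedE; last by move=> ? ? ? /= H1 H2; apply: ltn_trans H2 H1.
case/andP=> /allP lt_p0 s_sorted; rewrite big_cons eqxx; congr (_ + _).
  apply: eq_bigr => q _; congr F; rewrite /lift_above -map_comp.
  apply/eq_in_map => x /lt_p0 /= lt_x; rewrite /shift lt_x andbT ltnS.
  by rewrite addSn.
rewrite -IHs // big_seq [RHS]big_seq; apply: eq_bigr => p sp.
have lt_p : (p < p0)%N := lt_p0 p sp.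
rewrite (gtn_eqF lt_p); apply: eq_bigr => q _ /=; congr (F (_ :: _)).
by rewrite /shift [(p0 < p)%N]ltnNge (ltnW lt_p) andbF addn0.
Qed.

End Moves.

Lemma sum_ord_const_tail (V : nmodType) (F : nat -> V) m n X : (m <= n)%N ->
    (forall p, (m <= p)%N -> F p = X) ->
  \sum_(p < n) F p = X *+ (n - m) + \sum_(p < m) F p.
Proof.
move=> le_mn FX; rewrite -!(big_mkord xpredT F) (big_cat_nat (n := m)) //= addrC.
congr (_ + _); rewrite -sumr_const_nat.
by rewrite big_nat_cond [RHS]big_nat_cond; apply: eq_bigr => p /andP[/andP[/FX]].
Qed.

(** * The recursion of w from the differential equation *)

Section FlowMoves.
Variable y : {poly rat}.
Local Notation phi := (y^`()).

(** Let [c1] be the head of the list. For [p >= c1] nothing is lifted, which gives [c - c1] equal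
    terms. For [p < c1] the head becomes [c1.+1]; its operator does not depend on [p] and comes out
    of the sum, which is the same sum for the tail, with bound [c1]. *)
Lemma flowS_lift_sum c s : sorted geq (c :: s) ->
  \sum_(p < c) flowS y (lift_above p s) = c%:R * flowS y s + flowM y s.
Proof.
elim: s c => [|c1 s IHs] c srt.
  by rewrite /= sumr_const card_ord mulr_natl !addr0.
have /andP[le_c1 path_s] : (c1 <= c)%N && path geq c1 s by exact: srt.
rewrite (sum_ord_const_tail (F := fun p => flowS y (lift_above p (c1 :: s)))
  (X := flowS y (c1 :: s)) le_c1); last first.
  move=> p le_p; suff -> : lift_above p (c1 :: s) = c1 :: s by [].
  rewrite /lift_above [LHS]/= ltnNge le_p addn0; congr (_ :: _).
  rewrite -[RHS]map_id; apply/eq_in_map => x sx.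
  have le_x : (x <= c1)%N.
    move: path_s; rewrite path_sortedE; last first.
      by move=> ? ? ? /= H1 H2; apply: leq_trans H2 H1.
    by case/andP=> /allP/(_ x sx).
  by rewrite ltnNge (leq_trans le_x le_p) addn0.
rewrite (eq_bigr (fun p : 'I_c1 => flowS y (c1.+1 :: lift_above p s))); last first.
  by move=> p _; rewrite [lift_above _ _]/= ltn_ord addn1.
have -> : \sum_(p < c1) flowS y (c1.+1 :: lift_above p s) =
   phi * (\sum_(p < c1) flowS y (lift_above p s))^`() +
   (c1.+1%:R - (size s).*2%:R) * phi^`() * \sum_(p < c1) flowS y (lift_above p s).
  rewrite raddf_sum !mulr_sumr -big_split /=; apply: eq_bigr => p _.
  by rewrite size_lift_above.
rewrite -[_ *+ (c - c1)]mulr_natl (IHs c1) // natrB //.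
rewrite [flowS y (c1 :: s)]/= [flowM y (c1 :: s)]/=.
move: (flowS y s) (flowM y s) (size s) => S M k.
rewrite derivD derivM deriv_natr -(natr1 c1).
move: (c%:R : {poly rat}) (c1%:R : {poly rat}) (k.*2%:R : {poly rat}) => C C1 K.
ring.
Qed.

Lemma flowE_moves s : sorted geq s -> flowE y s = moves (flowS y) s.
Proof.
elim: s => [|c s IHs] //= path_s; have s_sorted := path_sorted path_s.
rewrite -addrA -(flowS_lift_sum (c := c)) // [LHS]addrC; congr (_ + _).
rewrite (IHs s_sorted).
(* Removing a mark after [c] shortens the tail by one, so the coefficient in [flowS] exceeds that
   for the full tail by 2. *)
symmetry; apply: (moves_additive (L := fun f =>
  phi * f^`() + (c%:R + 2%:R - (size s).*2%:R) * phi^`() * f)).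
- by rewrite deriv0 !mulr0 addr0.
- by move=> f g; rewrite derivD; ring.
move=> s1 <-; rewrite /= doubleS.
move: (flowS y s1) (size s1).*2 => S k; rewrite -(natr1 k.+1) -(natr1 k).
move: (c%:R : {poly rat}) (k%:R : {poly rat}) => C K.
ring.
Qed.

Lemma dvdp_deriv_exp N (f : {poly rat}) : 'X^(N.+1) %| f -> 'X^N %| f^`().
Proof.
case/dvdpP=> g ->; rewrite derivM derivXn /= dvdp_add //.
  by rewrite exprS mulrA dvdp_mull.
by rewrite mulrnAr -mulrnAl dvdp_mull.
Qed.

(** The error of the empty list is 0, and each entry costs one derivative, hence one order of
    divisibility. *)
Lemma flow_err_dvdp N s : 'X^((N + size s).+1) %| ode_defect y ->
  'X^(N.+1) %| flow_err y s.
Proof.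
elim: s N => [|c s IHs] N.
  by rewrite /flow_err /= -[1]polyC1 derivC !(mulr0, mul0r, subr0, addr0) dvdp0.
rewrite flow_err_cons /= addnS => dvd_rho.
have dvdS k (f : {poly rat}) : 'X^(k.+1) %| f -> 'X^k %| f.
  by apply: dvdp_trans; rewrite exprS dvdp_mull.
have le_exp (f : {poly rat}) : 'X^((N + size s).+2) %| f -> 'X^(N.+1) %| f.
  by apply: dvdp_trans; rewrite dvdp_exp2l //; lia.
have dvd_err : 'X^(N.+2) %| flow_err y s by apply: IHs; rewrite addSn.
rewrite !dvdp_sub ?dvdp_add //; apply: dvdp_mull.
- exact: dvdp_deriv_exp.
- exact: dvdS.
- apply: dvdp_trans (dvdp_deriv_exp dvd_rho).
  by rewrite dvdp_exp2l //; lia.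
- exact: le_exp.
Qed.

(** At 0 the error vanishes, and so do its terms with a factor [y] or ['X]. What is left is the
    recursion of w, up to the factorial. *)
Lemma flowE_at0 s : y.[0] = 0 -> phi.[0] = 1 ->
    'X^((size s).+1) %| ode_defect y ->
  (flowE y s).[0] = (size s)%:R * (flowS y s).[0].
Proof.
move=> y0 phi0 /(flow_err_dvdp (N := 0)) /dvdpP[g].
move/(congr1 (horner^~ 0)); rewrite /flow_err.
rewrite !hornerE -!polyC_natr !hornerE y0 phi0 /=.
by rewrite !(mulr0, mul0r, expr1n, mul1r, mulr1, subr0, addr0) => /eqP; rewrite subr_eq0 => /eqP.
Qed.

End FlowMoves.

(** * Zograf's recursion as a differential equation *)

Section Zograf.
Variable a : nat -> rat.
Hypothesis a0 : a 0%N = 1.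
Hypothesis a_rec : forall n : nat, (1 <= n)%N ->
  a n = 1 / 2%:R *
    \sum_(1 <= i < n.+1)
       (i * (n - i + 1))%N%:R / (n + 2)%N%:R
       * 'C(n - 1, i - 1)%:R * 'C(n + 3, i + 1)%:R * a (i - 1)%N * a (n - i)%N.

Definition wp_coef (m : nat) : rat :=
  if m is k.+1 then a k / (k.+1`! * k`!)%:R else 0.

Lemma wp_coefS k : wp_coef k.+1 = a k / (k.+1`!%:R * k`!%:R).
Proof. by rewrite -natrM. Qed.

Lemma wp_coef1 : wp_coef 1 = 1.
Proof. by rewrite /wp_coef a0 divr1. Qed.

Lemma fact_neq0 n : n`!%:R != 0 :> rat.
Proof. by rewrite pnatr_eq0 -lt0n fact_gt0. Qed.

Lemma factSr n : n.+1`!%:R = n.+1%:R * n`!%:R :> rat.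
Proof. by rewrite factS natrM. Qed.

Lemma natS_neq0 n : n.+1%:R != 0 :> rat.
Proof. by rewrite pnatr_eq0. Qed.

Lemma bin_div k l : 'C(k + l, k)%:R = (k + l)`!%:R / (k`!%:R * l`!%:R) :> rat.
Proof.
apply/(canRL (mulfK _)); first by rewrite mulf_neq0 ?fact_neq0.
by rewrite -!natrM -(bin_fact (leq_addr l k)) addKn.
Qed.

(** The recursion for [a n.+1], with its binomials absorbed by the factorials of [wp_coef]. *)
Lemma wp_coef_conv_sym n : 
  n.+1%:R * wp_coef n.+2 = n.+4%:R / 2%:R * \sum_(1 <= i < n.+2)
    i%:R * (n.+2 - i)%:R / (i.+1%:R * (n.+2 - i).+1%:R) * (wp_coef i * wp_coef (n.+2 - i)).
Proof.
rewrite wp_coefS a_rec // !mulr_sumr mulr_suml mulr_sumr.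
rewrite big_nat_cond [RHS]big_nat_cond; apply: eq_bigr => i.
case/andP=> /andP[i_gt0 lt_i] _; case: i i_gt0 lt_i => // k _ lt_k.
(* Writing [n = k + l] removes all natural subtractions and leaves a field identity in k, l and
   three factorials. *)
have [l Dn] : exists l, n = (k + l)%N by exists (n - k)%N; lia.
have -> : (n.+2 - k.+1 = l.+1)%N by lia.
have -> : (n.+1 - k.+1 = l)%N by lia.
have -> : (n.+1 - 1 = k + l)%N by lia.
have -> : (n.+1 + 3 = k.+2 + l.+2)%N by lia.
rewrite !subn1 !addn1 !succnK !bin_div !wp_coefS.
have -> : (k.+2 + l.+2 = n.+4)%N by lia.
rewrite -Dn addn2 [(k.+1 * l.+1)%:R]natrM !factSr.
have := (fact_neq0 n, fact_neq0 k, fact_neq0 l).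
case=> [[]]; rewrite -!natr1.
have := (natS_neq0 n, natS_neq0 n.+1, natS_neq0 n.+2, natS_neq0 n.+3,
         natS_neq0 k, natS_neq0 k.+1, natS_neq0 l, natS_neq0 l.+1).
case=> [[[[[[[]]]]]]]; rewrite -!natr1.
move: (n%:R : rat) (k%:R : rat) (l%:R : rat) (n`!%:R : rat) (k`!%:R : rat) (l`!%:R : rat)
  (a k) (a l) => N K L fn fk fl A B.
move=> h1 h2 h3 h4 h5 h6 h7 h8 h9 h10 h11; field.
by rewrite ?h1 ?h2 ?h3 ?h4 ?h5 ?h6 ?h7 ?h8 ?h9 ?h10 ?h11.
Qed.

(** The coefficient of x^m in (x y - int y) phi = x phi - y. It is the symmetric form undone: with i
    + j = n + 2, the terms of i and j add up to i j (1/(i+1) + 1/(j+1)), whose numerator i + j + 2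
    is the factor n + 4. *)
Lemma wp_coef_conv m : \sum_(i < m)
    i%:R / i.+1%:R * wp_coef i * ((m - i)%:R * wp_coef (m - i)) = (m%:R - 1) * wp_coef m.
Proof.
case: m => [|[|n]]; first by rewrite big_ord0 mulr0.
  by rewrite big_ord_recl big_ord0 /= !mul0r; ring.
have -> : n.+2%:R - 1 = n.+1%:R :> rat by rewrite -natr1 addrK.
rewrite wp_coef_conv_sym big_ord_recl [X in X + _]/= !mul0r add0r.
pose F i : rat := i%:R / i.+1%:R * wp_coef i * ((n.+2 - i)%:R * wp_coef (n.+2 - i)).
have -> : \sum_(i < n.+1) F i.+1 = \sum_(1 <= i < n.+2) F i.
  by rewrite big_add1 big_mkord.
have dblF : (\sum_(1 <= i < n.+2) F i) *+ 2 = \sum_(1 <= i < n.+2) (F i + F (n.+2 - i)%N).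
  rewrite big_split mulr2n /=; congr (_ + _); rewrite big_nat_rev /= add1n.
  by apply: eq_bigr => i _; rewrite subSS.
apply: (@mulfI _ 2%:R) => //; rewrite mulr_natl dblF !mulr_sumr.
rewrite big_nat_cond [RHS]big_nat_cond; apply: eq_bigr => i.
case/andP=> /andP[i_gt0 lt_i] _; rewrite /F subKn; last by lia.
have [l Dl] : exists l, (n.+2 - i = l)%N by exists (n.+2 - i)%N.
have -> : n.+4%:R = (i%:R + l%:R + 2%:R) :> rat by rewrite -!natrD; congr (_%:R); lia.
rewrite !Dl; have := (natS_neq0 i, natS_neq0 l); case; rewrite -!natr1.
move: (wp_coef i) (wp_coef l) (i%:R : rat) (l%:R : rat) => A B I L h1 h2; field.
by rewrite h1 h2.
Qed.

Definition wp_poly N : {poly rat} := \poly_(i < N) wp_coef i.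

Lemma dvdp_Xn_coef N (f : {poly rat}) : (forall i, (i < N)%N -> f`_i = 0) -> 'X^N %| f.
Proof.
move=> f0; rewrite -(poly_take_drop N f) (_ : take_poly N f = 0) ?add0r ?dvdp_mull //.
by apply/polyP => i; rewrite coef_poly coef0; case: ifP => // /f0.
Qed.

(** The coefficients of phi up to x^N need those of y up to x^(N+1). This makes the integrated
    equation hold modulo x^(N+1), and differentiating it costs one more order. *)
Lemma wp_poly_ode N : 'X^N %| ode_defect (wp_poly N.+2).
Proof.
set y := wp_poly _; pose Y : {poly rat} := \poly_(i < N.+3) (wp_coef i.-1 / i%:R).
have dY : Y^`() = y.
  apply/polyP=> i; rewrite coef_deriv !coef_poly ltnS succnK.
  case: ifP => _; last by rewrite mul0rn.
  by rewrite -(mulr_natr (_ / _)) divfK ?natS_neq0.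
(* theta is the once integrated equation; y phi' - x phi^3 is phi theta' - phi' theta. *)
pose theta := y^`() * ('X - 'X * y + Y) - y.
have dvd_theta : 'X^(N.+1) %| theta.
  apply: dvdp_Xn_coef => m lt_m.
  have -> : theta = 'X * y^`() - y - ('X * y - Y) * y^`() by rewrite /theta; ring.
  have cphi i : (i <= N)%N -> y^`()`_i = i.+1%:R * wp_coef i.+1.
    by move=> le_i; rewrite coef_deriv coef_poly !ltnS le_i mulr_natl.
  have cy i : (i <= N)%N -> y`_i = wp_coef i by move=> le_i; rewrite coef_poly ltnS leqW.
  have Y0 : Y`_0 = 0 by rewrite coef_poly mul0r.
  have cY i : (i <= N)%N -> Y`_i.+1 = wp_coef i / i.+1%:R.
    by move=> le_i; rewrite coef_poly !ltnS leqW.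
  have cX (p : {poly rat}) i : ('X * p)`_i.+1 = p`_i by rewrite coefXM.
  have cX0 (p : {poly rat}) : ('X * p)`_0 = 0 by rewrite coefXM.
  rewrite !coefB (coefM ('X * y - Y)) cy // big_ord_recl coefB cX0 Y0 subrr mul0r add0r.
  rewrite (eq_bigr (fun i : 'I_m => i%:R / i.+1%:R * wp_coef i * ((m - i)%:R * wp_coef (m - i)))).
    rewrite wp_coef_conv; case: m lt_m => [|m] lt_m.
      by rewrite cX0 [wp_coef 0]/= !mulr0 !subr0.
    rewrite cX cphi; last exact: ltnW.
    have key (r z : rat) : r * z - z - (r - 1) * z = 0 by ring.
    exact: key.
  move=> i _; have lt_i := ltn_ord i; rewrite [lift _ _ : nat]/= /bump add1n coefB cX.
  rewrite cy ?cY ?cphi; try lia.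
  have -> : (m - i.+1).+1 = (m - i)%N by lia.
  have := natS_neq0 i; rewrite -natr1 => h; field; exact: h.
have -> : ode_defect y = y^`() * theta^`() - y^`()^`() * theta.
  by rewrite /ode_defect /theta !(derivB, derivM, derivD, derivX, dY); ring.
rewrite dvdp_sub ?dvdp_mull ?dvdp_deriv_exp //.
by apply: dvdp_trans dvd_theta; rewrite dvdp_exp2l.
Qed.

(** In the step, differentiating the power of phi contributes the factor n, while c - 2k with c = n
    + 2 and k = n + 1 is -n; the two terms cancel. *)
Lemma flowS_rev_iota (y : {poly rat}) n :
  flowS y (rev (iota 1 n.+1)) = y^`() ^+ n * y^`(n.+2).
Proof.
elim: n => [|n IHn].
  by rewrite /= -[1]polyC1 derivC mulr0 add0r subr0 mulr1 mul1r.
have -> : rev (iota 1 n.+2) = n.+2 :: rev (iota 1 n.+1).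
  rewrite (_ : iota 1 n.+2 = iota 1 n.+1 ++ [:: n.+2]) ?rev_cat //.
  by rewrite -(iotaD 1 n.+1 1) addn1.
have szs : size (rev (iota 1 n.+1)) = n.+1 by rewrite size_rev size_iota.
move: (rev _) szs IHn => s szs IHn.
rewrite [LHS]/= szs IHn derivM deriv_exp -derivnS.
have -> : y^`() * (y^`()^`() * y^`() ^+ n.-1 *+ n * y^`(n.+2) + y^`() ^+ n * y^`(n.+3))
   = n%:R * y^`()^`() * y^`() ^+ n * y^`(n.+2) + y^`() ^+ n.+1 * y^`(n.+3).
  case: n {IHn szs} => [|n]; first by rewrite mulr0n !mul0r !add0r mul1r expr1.
  by rewrite -mulr_natl !exprS; ring.
rewrite doubleS -addnn exprS -(natr1 n.+1) -(natr1 (n + n).+1) -!natr1 natrD.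
move: (y^`(n.+2)) (y^`(n.+3)) (y^`()^`()) (y^`() ^+ n) (n%:R) => D2 D3 D1 P K.
ring.
Qed.

Lemma flowS_wp N n : (n < N)%N ->
  (flowS (wp_poly N.+1) (rev (iota 1 n))).[0] * n`!%:R = a n.
Proof.
case: n => [|n] lt_nN; first by rewrite /= hornerC a0 mul1r.
rewrite flowS_rev_iota hornerM horner_exp !horner_coef0 coef_deriv coef_derivn !coef_poly.
rewrite addn0 ffactnn !ltnS lt_nN (leq_ltn_trans _ lt_nN) // wp_coef1 mulr1n expr1n mul1r.
by rewrite wp_coefS -(mulr_natr (_ / _)) -[LHS]mulrA divfK ?mulf_neq0 ?fact_neq0.
Qed.

End Zograf.

(** * Codes of decompositions *)

Section Completions.

Lemma shift_mono q p x1 x2 : (q <= p)%N -> x1 != p -> x2 != p ->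
  (shift q p x1 < shift q p x2)%N = (x1 < x2)%N.
Proof. by rewrite /shift => *; lia. Qed.

Lemma shift_inj q p : (q <= p)%N -> {in predC1 p &, injective (shift q p)}.
Proof. by move=> le_qp x1 x2; rewrite !inE /shift; lia. Qed.

Lemma shift_neq q p x : (q <= p)%N -> x != p -> shift q p x != q.
Proof. by rewrite /shift; lia. Qed.

(** [v] lists positions in the order of deletion. The strip inserted at [q] is not recorded, as it
    outlives the steps that are counted. *)
Fixpoint completions m (v : seq nat) : nat :=
  match m, v with
  | m'.+1, p :: v' => \sum_(q < p.+1) completions m' [seq shift q p x | x <- v']
  | _, _ => 1
  end.

Definition sum_completions b : nat :=
  \sum_(v <- permutations b) completions (size b) v.

Lemma sum_permutations_head (V : nmodType) (F : seq nat -> V) b : uniq b -> b != [::] ->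
  \sum_(v <- permutations b) F v =
  \sum_(p <- b) \sum_(v <- permutations (rem p b)) F (p :: v).
Proof.
move=> b_uniq b_neq0.
rewrite (perm_big _ (permutationsE _)) ?lt0n ?size_eq0 //= undup_id //.
by rewrite big_allpairs_dep.
Qed.

Lemma sum_permutations_map (V : nmodType) (F : seq nat -> V) (f : nat -> nat) b :
    uniq b -> {in b &, injective f} ->
  \sum_(v <- permutations (map f b)) F v = \sum_(v <- permutations b) F (map f v).
Proof.
move=> b_uniq f_inj; rewrite -(big_map (map f) xpredT F); apply: perm_big.
have fb_uniq : uniq (map f b) by rewrite map_inj_in_uniq.
have map_uniq : uniq (map (map f) (permutations b)).
  rewrite map_inj_in_uniq ?permutations_uniq // => v1 v2.
  rewrite !mem_permutations => /perm_mem b_v1 /perm_mem b_v2.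
  by apply: (inj_in_map f_inj); apply/allP => x; rewrite (b_v1, b_v2).
apply: uniq_perm => //; first exact: permutations_uniq.
move=> v; have [||_ eq_mem] := uniq_min_size map_uniq (s2 := permutations (map f b)).
- by move=> _ /mapP[u b_u ->]; rewrite !mem_permutations perm_map // -mem_permutations.
- by rewrite size_map !size_permutations // size_map.
by rewrite eq_mem.
Qed.

(** Split by the first deleted position [p]. Away from [p] the shift is injective, so it carries the
    orders of the other positions to those of their images. *)
Lemma sum_completions_rec b : uniq b -> b != [::] ->
  sum_completions b =
    \sum_(p <- b) \sum_(q < p.+1) sum_completions [seq shift q p x | x <- rem p b].
Proof.
move=> b_uniq b_neq0; rewrite /sum_completions sum_permutations_head //.
rewrite big_seq [RHS]big_seq; apply: eq_bigr => p bp.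
have -> : size b = (size (rem p b)).+1 by rewrite size_rem // prednK // lt0n size_eq0.
rewrite exchange_big /=; apply: eq_bigr => q _.
rewrite size_map sum_permutations_map ?rem_uniq // => x1 x2.
rewrite !mem_rem_uniq // => /andP[/= ne1 _] /andP[/= ne2 _].
by apply: shift_inj => //; rewrite -ltnS.
Qed.

(** Both sides satisfy the same recursion: [moves_sorted] and [flowE_moves] turn the sum over first
    steps into [flowE], whose value at 0 is [size b] times that of [flowS]. These factors build up
    the factorial. *)
Lemma sum_completions_flow (y : {poly rat}) b : y.[0] = 0 -> y^`().[0] = 1 ->
    'X^((size b).+1) %| ode_defect y -> sorted gtn b ->
  (sum_completions b)%:R = (size b)`!%:R * (flowS y [seq x.+1 | x <- b]).[0].
Proof.
move=> y0 dy0; have [m] := ubnP (size b); elim: m b => // m IHm b lt_m dvd_b b_sorted.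
have gtn_trans : transitive gtn by move=> ? ? ? /= H1 H2; apply: ltn_trans H2 H1.
have b_uniq : uniq b by apply: sorted_uniq b_sorted => // x; rewrite /= ltnn.
have [-> | b_neq0] := eqVneq b [::].
  by rewrite /sum_completions big_seq1 /= hornerC mul1r.
have sz_gt0 : (0 < size b)%N by rewrite lt0n size_eq0.
rewrite sum_completions_rec // raddf_sum /=.
transitivity ((size b).-1`!%:R * (moves (flowS y) [seq x.+1 | x <- b]).[0]); last first.
  rewrite -flowE_moves; last first.
    by rewrite sorted_map; apply: (sub_sorted _ b_sorted) => x1 x2; apply: ltnW.
  rewrite flowE_at0 ?size_map // mulrA -natrM mulnC.
  by rewrite -{1}(prednK sz_gt0) -factS prednK.
rewrite -moves_sorted // horner_sum mulr_sumr big_seq [RHS]big_seq.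
apply: eq_bigr => p bp; rewrite raddf_sum horner_sum mulr_sumr /=.
apply: eq_bigr => q _; have le_qp : (q <= p)%N by rewrite -ltnS.
have sz : size (rem p b) = (size b).-1 by rewrite size_rem.
rewrite IHm ?size_map ?sz -?map_comp //.
- by rewrite prednK // -ltnS.
- by rewrite prednK //; apply: dvdp_trans dvd_b; rewrite dvdp_exp2l.
(* The shift preserves the order of entries other than [p], so the new list is still decreasing. *)
rewrite sorted_map; have := subseq_sorted gtn_trans (rem_subseq p b) b_sorted.
have : p \notin rem p b by rewrite mem_rem_uniq // !inE eqxx.
elim: (rem p b) => // x1 [|x2 s] //= IHs; rewrite !inE !negb_or.
case/and3P=> ne1 ne2 nes /andP[lt12 path_s].
rewrite shift_mono 1?eq_sym // lt12 /=; apply: IHs => //.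
by rewrite inE negb_or ne2.
Qed.

End Completions.

(** * Lists of positions and admissible codes *)

Section Codes.
Local Open Scope nat_scope.

(* Entry i of V is the position, on the current diagonal d, of the strip that
   starts on the diagonal d + i - (n - 1); the head is the strip that ends here. *)
Definition next q V := rcons [seq shift q (head 0 V) x | x <- behead V] q.

Definition run V c := foldl (fun V q => next q V) V c.

(** Here [d] is the diagonal about to be entered. Its boxes have positions at most [d], and a new
    strip is inserted at or below the deleted one; hence the minimum. *)
Fixpoint codes m d V : seq (seq nat) :=
  if m is m'.+1 then
    [seq q :: r | q <- iota 0 (minn d (head 0 V)).+1, r <- codes m' d.+1 (next q V)]
  else [:: [::]].

Lemma codesS m d V : codes m.+1 d V =
  [seq q :: r | q <- iota 0 (minn d (head 0 V)).+1, r <- codes m d.+1 (next q V)].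
Proof. by []. Qed.

Lemma codes_uniq m d V : uniq (codes m d V).
Proof.
elim: m d V => [|m IHm] d V //; rewrite codesS; apply: allpairs_uniq_dep => //.
  exact: iota_uniq.
by move=> [q1 r1] [q2 r2] _ _ /= [-> ->].
Qed.

Lemma codesP m d V c : reflect
  (size c = m /\ forall k, k < m -> nth 0 c k <= minn (d + k) (head 0 (run V (take k c))))
  (c \in codes m d V).
Proof.
elim: m d V c => [|m IHm] d V c.
  by rewrite inE; apply: (iffP eqP) => [->|[/size0nil-> _]].
rewrite codesS; apply: (iffP allpairsPdep) => [[q [r [] ]]|[]].
  rewrite mem_iota ltnS /= => le_q /IHm[sz_r le_r] ->; split; first by rewrite /= sz_r.
  by case=> [|k] lt_k; rewrite ?addn0 ?addnS -?addSn //=; apply: le_r.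
case: c => // q r [sz_r] le_r; exists q, r; split=> //.
  by have:= le_r 0; rewrite addn0 mem_iota ltnS; apply.
by apply/IHm; split=> // k lt_k; have:= le_r k.+1 lt_k; rewrite addnS -addSn.
Qed.

Lemma size_codes_add m1 m2 d V :
  size (codes (m1 + m2) d V) =
    \sum_(r <- codes m1 d V) size (codes m2 (d + m1) (run V r)).
Proof.
elim: m1 d V => [|m1 IHm] d V; first by rewrite big_seq1 addn0.
rewrite addSn !codesS size_allpairs_dep big_allpairs_dep sumnE big_map.
by apply: eq_bigr => q _; rewrite IHm addSnnS.
Qed.

Lemma perm_iotaE V n : perm_eq V (iota 0 n) =
  [&& uniq V, size V == n & all (fun x => x < n) V].
Proof.
apply/idP/and3P=> [V_n | [V_uniq /eqP sz_V /allP V_lt]].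
  rewrite (perm_uniq V_n) iota_uniq (perm_size V_n) size_iota eqxx; split=> //.
  by apply/allP=> x; rewrite (perm_mem V_n) mem_iota.
have [||_ eqV] := uniq_min_size V_uniq (s2 := iota 0 n).
- by move=> x /V_lt; rewrite mem_iota.
- by rewrite size_iota sz_V.
by apply: uniq_perm; rewrite ?iota_uniq.
Qed.

Lemma perm_next n q V : 0 < n -> q <= head 0 V ->
  perm_eq V (iota 0 n) -> perm_eq (next q V) (iota 0 n).
Proof.
rewrite !perm_iotaE /next => n_gt0 le_q /and3P[V_uniq /eqP sz_V V_lt].
case: V le_q V_uniq sz_V V_lt => [|p U] /=; first by case: n n_gt0.
move=> le_q /andP[U'p U_uniq] sz_U /andP[lt_p /allP U_lt].
have neqp x : x \in U -> x != p by apply: contraTneq => ->.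
rewrite rcons_uniq size_rcons size_map sz_U eqxx all_rcons (leq_ltn_trans le_q) //=.
rewrite map_inj_in_uniq; last by move=> x1 x2 /neqp ? /neqp ?; apply: shift_inj.
rewrite U_uniq andbT; apply/andP; split.
  by apply/mapP=> [[x /neqp ne_x eq_q]]; have := shift_neq le_q ne_x; rewrite -eq_q eqxx.
by apply/allP=> _ /mapP[x /U_lt lt_x ->]; rewrite /shift; lia.
Qed.

Lemma head_lt n V : 0 < n -> perm_eq V (iota 0 n) -> head 0 V < n.
Proof. by rewrite perm_iotaE => n_gt0 /and3P[_ _]; case: V => //= p U /andP[]. Qed.

(** Positions are below [n], so from the diagonal [n] on only the deleted position bounds the new
    one, and [m <= n] steps delete just the first [m] entries of [V]. *)
Lemma size_codes_completions n m d V : m <= n <= d -> perm_eq V (iota 0 n) ->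
  size (codes m d V) = completions m (take m V).
Proof.
elim: m d V => [|m IHm] d V // /andP[lt_mn le_nd] V_n.
have n_gt0 : 0 < n by apply: leq_ltn_trans lt_mn.
have lt_head := head_lt n_gt0 V_n.
have sz_V : size V = n by rewrite (perm_size V_n) size_iota.
rewrite codesS size_allpairs_dep sumnE big_map (minn_idPr _); last by lia.
case: V V_n sz_V lt_head => [|p U] V_n sz_V lt_head; first by rewrite -sz_V in n_gt0.
rewrite -[iota 0 _]/(index_iota 0 p.+1) big_mkord; apply: eq_bigr => q _.
rewrite (IHm d.+1); first 1 last; first by lia.
  by apply: perm_next; rewrite // -ltnS.
congr completions; rewrite /next /= -cats1 takel_cat ?map_take //.
by rewrite size_map; move: sz_V lt_mn => /= <-.
Qed.

(* Entries whose index d + i - (n - 1) is outside [0, 2n) stand for tiles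
   outside of the rectangle; they are placed at the positions n - 1 - i. *)
Definition state n d V :=
  perm_eq V (iota 0 n) /\
  forall i, i < n -> (d + i < n.-1) || (3 * n <= (d + i).+1) -> nth 0 V i = n.-1 - i.

(** On the diagonal 0 only the last entry, 0, stands for a tile of the rectangle. *)
Definition start n := rev (iota 0 n).

Lemma state_start n : 0 < n -> state n 0 (start n).
Proof.
move=> n_gt0; split=> [|i lt_i _]; first by rewrite perm_rev.
by rewrite nth_rev size_iota // nth_iota //; lia.
Qed.

Lemma nth_next n q V i : size V = n -> i < n -> 0 < n ->
  nth 0 (next q V) i = if i == n.-1 then q else shift q (head 0 V) (nth 0 V i.+1).
Proof.
case: V => [|p U] <- //= lt_i _.
rewrite nth_rcons size_map; case: ltnP => [lt_iU | le_iU].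
  by rewrite (ltn_eqF lt_iU) (nth_map 0).
by rewrite [i == _](_ : _ = true) //; apply/eqP; apply/anti_leq; rewrite le_iU -ltnS lt_i.
Qed.

(** Outside entries fill the positions above [d] on the left and the lowest positions on the right.
    An insertion below the former, or at 0, raises each surviving one by one while its index drops
    by one. *)
Lemma state_next n d q V : 0 < n -> d.+1 < (3 * n).-1 ->
    state n d V -> q <= minn d.+1 (head 0 V) -> (2 * n <= d.+1 -> q = 0) ->
  state n d.+1 (next q V).
Proof.
move=> n_gt0 lt_d [V_n V_phant]; rewrite leq_min => /andP[le_qd le_q] q0.
split=> [|i lt_i phant]; first exact: perm_next.
have /and3P[V_uniq /eqP sz_V _] : [&& uniq V, size V == n & all (fun x => x < n) V].
  by rewrite -perm_iotaE.
rewrite (nth_next _ sz_V) //; case: eqP => [Di | ne_i]; first by rewrite q0; lia.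
rewrite V_phant; try lia; rewrite -nth0 /shift.
case/orP: phant => [lt_di | le_di].
  by rewrite V_phant; lia.
have nth_inj : forall j, j < n -> nth 0 V 0 = nth 0 V j -> 0 = j.
  by move=> j lt_j /eqP; rewrite nth_uniq ?sz_V // => /eqP.
(* A head not above this outside entry would sit at the position of an outside entry of positive
   index, contradicting distinctness. *)
case: (leqP (n.-1 - i) (nth 0 V 0)) => [le_h | lt_h]; first by rewrite q0; lia.
have lt0n : nth 0 V 0 < n by rewrite nth0 head_lt.
have lt_j : n.-1 - nth 0 V 0 < n by lia.
have phant_j : 3 * n <= (d + (n.-1 - nth 0 V 0)).+1 by lia.
have := nth_inj _ lt_j; rewrite (V_phant _ lt_j) ?phant_j ?orbT //; lia.
Qed.

Lemma run_rcons V c q : run V (rcons c q) = next q (run V c).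
Proof. by rewrite /run foldl_rcons. Qed.

Lemma state_run n m d V c : 0 < n -> d + m < (3 * n).-1 -> state n d V ->
    c \in codes m d.+1 V -> (forall k, k < m -> 2 * n <= d.+1 + k -> nth 0 c k = 0) ->
  state n (d + m) (run V c).
Proof.
move=> n_gt0; elim: m d V c => [|m IHm] d V c; first by rewrite inE addn0 => _ ? /eqP->.
move=> lt_d V_st; rewrite codesS => /allpairsPdep[q [r [le_q cr ->]]] c0 /=; rewrite -addSnnS.
apply: IHm => //; try lia.
  apply: state_next => //; try lia; first by move: le_q; rewrite mem_iota.
  by move=> le_d; apply: (c0 0); rewrite ?addn0.
by move=> k lt_k le_k; apply: (c0 k.+1); lia.
Qed.

End Codes.

(** * Counting the codes *)

Section CountCodes.
Local Open Scope nat_scope.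

Lemma state_head n d V : state n d V -> d < n.-1 -> exists U,
  [/\ V = n.-1 :: U, (size U).+1 = n & {in U, forall x, x != n.-1}].
Proof.
case=> V_n V_phant lt_d; have n_gt0 : 0 < n by lia.
have := V_n; rewrite perm_iotaE.
have := V_phant 0 n_gt0; rewrite addn0 subn0 lt_d => /(_ isT).
case: V {V_phant V_n} => [|p U] /=; first by move=> _ /andP[/eqP]; lia.
move=> -> /and3P[/andP[U'p _] /eqP sz_U _]; exists U; split=> // x.
by apply: contraTneq => ->.
Qed.

Lemma state_next_left n d q V : d < n.-1 -> state n d V -> q <= d.+1 ->
  state n d.+1 (next q V).
Proof.
move=> lt_d V_st le_q; have [U [DV _ _]] := state_head V_st lt_d.
by apply: state_next => //; rewrite ?DV /=; lia.
Qed.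

Lemma minn_state_head n d V : state n d V -> d < n.-1 -> minn d.+1 (head 0 V) = d.+1.
Proof. by move=> V_st lt_d; have [U [-> _ _]] := state_head V_st lt_d; apply/minn_idPl. Qed.

(** A step can be undone: the last entry reveals [q], and the deleted head is the outside entry
    [n.-1], so the shift is known and injective on the rest. *)
Lemma codes_run_inj n m d V1 V2 c1 c2 : d + m < n ->
    state n d V1 -> state n d V2 -> c1 \in codes m d.+1 V1 -> c2 \in codes m d.+1 V2 ->
  run V1 c1 = run V2 c2 -> V1 = V2 /\ c1 = c2.
Proof.
elim: m d V1 V2 c1 c2 => [|m IHm] d V1 V2 c1 c2 lt_d st1 st2.
  by rewrite !inE => /eqP-> /eqP->.
have lt_dn : d < n.-1 by lia.
rewrite !codesS (minn_state_head st1) // (minn_state_head st2) //.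
case/allpairsPdep=> [q1 [r1 [le_q1 r1P ->]]] /allpairsPdep[q2 [r2 [le_q2 r2P ->]]] /=.
rewrite !mem_iota !ltnS /= in le_q1 le_q2.
case/(IHm _ _ _ _ _ _ _ _ r1P r2P) => [|||eq_next ->]; rewrite ?addSnnS //.
- exact: state_next_left.
- exact: state_next_left.
have [U1 [DV1 _ U1n]] := state_head st1 lt_dn; have [U2 [DV2 _ U2n]] := state_head st2 lt_dn.
move: eq_next; rewrite /next DV1 DV2 => /rcons_inj[/= eqU eq_q]; rewrite eq_q in eqU *; split=> //.
congr (_ :: _); move: eqU; apply: (inj_in_map (A := predC1 n.-1)).
- by apply: shift_inj; lia.
- by apply/allP.
- by apply/allP.
Qed.

(** On the left the head is [n.-1] and does not restrict the choice, so entering the diagonal [d.+1]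
    offers [d.+2] positions. *)
Lemma size_codes_left n m d V : d + m < n -> state n d V ->
  size (codes m d.+1 V) * (d.+1)`! = (d + m).+1`!.
Proof.
elim: m d V => [|m IHm] d V lt_d V_st; first by rewrite mul1n addn0.
rewrite codesS (minn_state_head V_st); last by lia.
rewrite size_allpairs_dep sumnE big_map.
apply/eqP; rewrite -(eqn_pmul2l (ltn0Sn d.+1)) mulnCA -factS big_distrl [X in X == _]/=.
rewrite -[[:: 0, 1 & _]]/(iota 0 d.+2).
rewrite big_seq (eq_bigr (fun=> (d + m.+1).+1`!)) => [|q]; last first.
  rewrite mem_iota ltnS addnS -addSn => le_q; apply: IHm; first by lia.
  by apply: state_next_left => //; lia.
by rewrite -big_seq big_const_seq count_predT size_iota iter_addn_0 mulnC.
Qed.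

(** The first [n.-1] insertions reach every permutation of the positions exactly once, by
    injectivity and the count n!. The remaining [n] insertions are completions. *)
Lemma size_codes n : 0 < n ->
  size (codes (2 * n).-1 1 (start n)) = sum_completions (rev (iota 0 n)).
Proof.
move=> n_gt0; have st0 := state_start n_gt0.
have -> : (2 * n).-1 = n.-1 + n by lia.
have runP c : c \in codes n.-1 1 (start n) -> perm_eq (run (start n) c) (iota 0 n).
  move=> cP; have [] // := state_run n_gt0 _ st0 cP; first by lia.
  by move=> k; lia.
have runs_perm : perm_eq [seq run (start n) c | c <- codes n.-1 1 (start n)]
    (permutations (rev (iota 0 n))).
  have map_uniq : uniq [seq run (start n) c | c <- codes n.-1 1 (start n)].
    rewrite map_inj_in_uniq ?codes_uniq // => c1 c2 c1P c2P eq_run.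
    have lt_n : 0 + n.-1 < n by lia.
    by have [] := codes_run_inj lt_n st0 st0 c1P c2P eq_run.
  apply: uniq_perm => //; first exact: permutations_uniq.
  have [||_ //] := uniq_min_size map_uniq (s2 := permutations (rev (iota 0 n))).
    move=> _ /mapP[c cP ->]; rewrite mem_permutations; apply: perm_trans (runP c cP) _.
    by rewrite perm_sym perm_rev.
  rewrite size_permutations ?rev_uniq ?iota_uniq // size_rev size_iota size_map.
  have := size_codes_left (m := n.-1) _ st0; rewrite add0n prednK // muln1 => <- //.
rewrite size_codes_add /sum_completions size_rev size_iota -(perm_big _ runs_perm) big_map.
rewrite big_seq [RHS]big_seq; apply: eq_bigr => c cP.
have V_n := runP c cP; rewrite add1n prednK // (size_codes_completions _ V_n) ?leqnn //.
by rewrite take_oversize // (perm_size V_n) size_iota.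
Qed.

End CountCodes.

Lemma size_codes_wp (a : nat -> rat) n : (0 < n)%N -> a 0%N = 1 ->
    (forall n : nat, (1 <= n)%N ->
     a n = 1 / 2%:R *
       \sum_(1 <= i < n.+1)
          (i * (n - i + 1))%N%:R / (n + 2)%N%:R
          * 'C(n - 1, i - 1)%:R * 'C(n + 3, i + 1)%:R * a (i - 1)%N * a (n - i)%N) ->
  (size (codes (2 * n).-1 1 (start n)))%:R = a n.
Proof.
move=> n_gt0 a0 a_rec; rewrite size_codes //.
have sz : size (rev (iota 0 n)) = n by rewrite size_rev size_iota.
(* Keeping [n.+3] coefficients makes the defect divisible by ['X^(n.+1)], as required for [n]
   marks. *)
rewrite (sum_completions_flow (y := wp_poly a n.+3)) ?sz.
- rewrite mulrC map_rev -[map _ _]/(map (addn 1) _) -iotaDl.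
  by apply: flowS_wp; rewrite ?leqnSn.
- by rewrite horner_coef0 coef_poly.
- by rewrite horner_coef0 coef_deriv coef_poly wp_coef1.
- exact: wp_poly_ode.
by rewrite rev_sorted; apply: iota_ltn_sorted.
Qed.

(** * Border strips and diagonals *)

Section Ribbons.
Local Open Scope nat_scope.
Variables r c : nat.
Implicit Types (x y z : box r c) (S : {set box r c}).

(* The row counted from the bottom, so that dg is constant on diagonals. *)
Definition pos x : nat := r.-1 - x.1.

Definition dg x : nat := x.2 + pos x.

(** A border strip of [k] boxes read diagonal by diagonal, starting on the diagonal [l]. *)
Definition ribbon l k S :=
  [&& #|S| == k, [forall x in S, l <= dg x < l + k],
      [forall x in S, forall y in S, (dg x == dg y) ==> (x == y)]
    & [forall x in S, forall y in S, (dg y == (dg x).+1) ==> adjacent x y]].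

Lemma ribbonP l k S : reflect
  [/\ #|S| = k, {in S, forall x, l <= dg x < l + k}, {in S &, injective dg}
    & {in S &, forall x y, dg y = (dg x).+1 -> adjacent x y}]
  (ribbon l k S).
Proof.
apply: (iffP and4P) => [[/eqP cS /forall_inP lS /forall_inP iS /forall_inP aS] | [cS lS iS aS]].
  split=> // x y xS yS.
    by move=> /eqP eq_xy; apply/eqP; apply: (implyP (forall_inP (iS x xS) y yS)).
  by move=> /eqP eq_xy; apply: (implyP (forall_inP (aS x xS) y yS)).
split; first exact/eqP.
- exact/forall_inP.
- by apply/forall_inP=> x xS; apply/forall_inP=> y yS; apply/implyP=> /eqP/iS->.
- by apply/forall_inP=> x xS; apply/forall_inP=> y yS; apply/implyP=> /eqP/aS->.
Qed.

Lemma box_eq x y : pos x = pos y -> dg x = dg y -> x = y.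
Proof.
case: x y => [[i lt_i] [j lt_j]] [[i' lt_i'] [j' lt_j']]; rewrite /dg /pos /= => eq_p eq_d.
by congr (_, _); apply: val_inj => /=; lia.
Qed.

Lemma pos_lt x : pos x < r.
Proof. by case: x => [[i lt_i] j]; rewrite /pos /=; lia. Qed.

Lemma pos_le_dg x : pos x <= dg x.
Proof. exact: leq_addl. Qed.

Lemma dg_lt x : dg x < c + pos x.
Proof. by rewrite ltn_add2r. Qed.

Lemma ex_box p d : p < r -> p <= d < c + p -> exists x, pos x = p /\ dg x = d.
Proof.
move=> lt_p /andP[le_pd lt_d].
have lt_i : r.-1 - p < r by lia.
have lt_j : d - p < c by lia.
by exists (Ordinal lt_i, Ordinal lt_j); rewrite /dg /pos /=; lia.
Qed.

Lemma adjacent_up x y : dg y = (dg x).+1 ->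
  adjacent x y = (pos y == pos x) || (pos y == (pos x).+1).
Proof.
case: x y => [[i lt_i] [j lt_j]] [[i' lt_i'] [j' lt_j']].
rewrite /adjacent /dg /pos -!val_eqE /= => eq_d; apply/idP/idP; lia.
Qed.

Lemma adjacent_dg x y : adjacent x y -> dg y = (dg x).+1 \/ dg x = (dg y).+1.
Proof.
case: x y => [[i lt_i] [j lt_j]] [[i' lt_i'] [j' lt_j']].
rewrite /adjacent /dg /pos -!val_eqE /=; lia.
Qed.

Lemma adjacent_sym x y : adjacent x y = adjacent y x.
Proof.
rewrite /adjacent ![y.1 == _]eq_sym ![y.2 == _ :> 'I__]eq_sym.
by congr (_ && _ || _ && _); exact: orbC.
Qed.

Lemma ribbon_diag l k S d : ribbon l k S -> l <= d < l + k -> exists2 x, x \in S & dg x = d.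
Proof.
case/ribbonP=> cS lS iS _ d_l.
have map_uniq : uniq [seq dg x | x <- enum S].
  by rewrite map_inj_in_uniq ?enum_uniq // => x y; rewrite !mem_enum; apply: iS.
have [||_ eq_mem] := uniq_min_size map_uniq (s2 := iota l k).
- by move=> _ /mapP[x xS ->]; rewrite mem_iota lS // -mem_enum.
- by rewrite size_map -cardE cS size_iota.
have : d \in [seq dg x | x <- enum S] by rewrite eq_mem mem_iota.
by case/mapP=> x; rewrite mem_enum => xS ->; exists x.
Qed.

Lemma ribbon_level l1 l2 k S : 0 < k -> ribbon l1 k S -> ribbon l2 k S -> l1 = l2.
Proof.
move=> k_gt0 rib1 rib2; have /ribbonP[_ lS1 _ _] := rib1; have /ribbonP[_ lS2 _ _] := rib2.
have [|x1 x1S D1] := ribbon_diag (d := l1) rib1; first by lia.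
have [|x2 x2S D2] := ribbon_diag (d := l2) rib2; first by lia.
by have [? ?] := (lS1 x2 x2S, lS2 x1 x1S); lia.
Qed.

Lemma ribbon_mono l k S x y : ribbon l k S -> x \in S -> y \in S -> dg x <= dg y ->
  pos x <= pos y /\ x.2 <= y.2.
Proof.
move=> rib xS yS le_xy; have /ribbonP[_ lS iS aS] := rib.
have [m] := ubnP (dg y - dg x); elim: m y yS le_xy => // m IHm y yS le_xy lt_m.
move: le_xy; rewrite leq_eqVlt => /orP[/eqP eq_d | lt_xy].
  by rewrite (iS x y xS yS eq_d).
have [|z zS Dz] := ribbon_diag (d := (dg y).-1) rib.
  by have [? ?] := (lS x xS, lS y yS); lia.
have [||le1 le2] := IHm z zS; try lia.
have Dy : dg y = (dg z).+1 by lia.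
have := aS z y zS yS Dy; rewrite adjacent_up //.
by move: Dy; rewrite /dg; lia.
Qed.

(** A ribbon runs weakly up and to the right, so if [z] is weakly below and to the right of [x],
    both share a row or a column. The box of [S] on the diagonal of [y] is squeezed into that line
    and equals [y]. *)
Lemma ribbon_convex l k S x y z : ribbon l k S -> x \in S -> z \in S ->
  x.1 <= y.1 <= z.1 -> x.2 <= y.2 <= z.2 -> y \in S.
Proof.
move=> rib xS zS y1 y2; have /ribbonP[_ lS _ _] := rib.
have [lx lz] := (lS x xS, lS z zS).
have py : pos z <= pos y <= pos x by rewrite /pos; lia.
case: (leqP (dg x) (dg z)) => [le_xz | /ltnW le_zx].
  have [le1 le2] := ribbon_mono rib xS zS le_xz.
  have [|w wS Dw] := ribbon_diag (d := dg y) rib; first by move: lx lz; rewrite /dg; lia.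
  have [|le3 _] := ribbon_mono rib xS wS; first by rewrite Dw /dg; lia.
  have [|le4 _] := ribbon_mono rib wS zS; first by rewrite Dw /dg; lia.
  by rewrite -(@box_eq w y) //; lia.
have [le1 le2] := ribbon_mono rib zS xS le_zx.
have [|w wS Dw] := ribbon_diag (d := dg y) rib; first by move: lx lz; rewrite /dg; lia.
have [|_ le3] := ribbon_mono rib zS wS; first by rewrite Dw /dg; lia.
have [|_ le4] := ribbon_mono rib wS xS; first by rewrite Dw /dg; lia.
by rewrite -(@box_eq w y) //; move: Dw; rewrite /dg; lia.
Qed.

Lemma convex_skew_shape S :
    (forall x y z, x \in S -> z \in S -> x.1 <= y.1 <= z.1 -> x.2 <= y.2 <= z.2 -> y \in S) ->
  skew_shape S.
Proof.
(* The outer diagram is the order ideal generated by [S]; convexity makes its complement of [S] an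
   ideal too. *)
move=> convS; pose lam := [set x : box r c | [exists z in S, (x.1 <= z.1) && (x.2 <= z.2)]].
have lamP x z : z \in S -> x.1 <= z.1 -> x.2 <= z.2 -> x \in lam.
  by move=> zS le1 le2; rewrite inE; apply/exists_inP; exists z; rewrite ?le1.
apply/existsP; exists lam; apply/existsP; exists (lam :\: S); apply/and4P; split.
- apply/forallP=> x; apply/forallP=> y; apply/implyP=> /and3P[].
  rewrite inE => /exists_inP[z zS /andP[le1 le2]] le_x1 le_x2.
  by apply: lamP zS _ _; [apply: leq_trans le1 | apply: leq_trans le2].
- apply/forallP=> x; apply/forallP=> y; apply/implyP=> /and3P[].
  rewrite !in_setD => /andP[yS]; rewrite {1}inE => /exists_inP[z zS /andP[le1 le2]] le_x1 le_x2.
  rewrite (lamP x z) ?andbT //; try by [apply: leq_trans le1 | apply: leq_trans le2].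
  by apply: contra yS => xS; apply: (convS x y z); rewrite ?le_x1 ?le_x2.
- exact: subsetDl.
apply/eqP/setP=> x; rewrite !in_setD negb_and negbK andb_orl andNb orbF.
by apply/idP/andP=> [xS | [] //]; split=> //; apply: lamP xS _ _.
Qed.

Lemma skew_shape_convex S : skew_shape S ->
  forall x y z, x \in S -> z \in S -> x.1 <= y.1 <= z.1 -> x.2 <= y.2 <= z.2 -> y \in S.
Proof.
case/existsP=> lam /existsP[mu /and4P[/forallP lamY /forallP muY _ /eqP->]] x y z.
rewrite !in_setD => /andP[mu'x _] /andP[_ lam_z] /andP[xy1 yz1] /andP[xy2 yz2].
have /forallP/(_ z) := lamY y; rewrite lam_z yz1 yz2 /= => ->; rewrite andbT.
apply: contra mu'x => mu_y.
by have /forallP/(_ y) := muY x; rewrite mu_y xy1 xy2.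
Qed.

(** A discrete intermediate value argument along the path. *)
Lemma connect_crossing (e : rel (box r c)) x y d :
    (forall u v, e u v -> dg v <= (dg u).+1) -> connect e x y -> dg x <= d < dg y ->
  exists u v, [/\ e u v, dg u = d & dg v = d.+1].
Proof.
move=> e_dg /connectP[p]; elim: p x => [|u p IHp] x /=.
  by move=> _ -> /andP[? ?]; lia.
case/andP=> e_xu path_p Dy /andP[le_xd lt_d].
case: (leqP (dg u) d) => [le_ud | lt_du].
  by apply: IHp path_p Dy _; rewrite le_ud.
by exists x, u; have := e_dg _ _ e_xu; split=> //; lia.
Qed.

(** Two boxes of [S] on one diagonal would, by convexity, span a 2 x 2 square in [S]. Connectedness
    forces [S] to meet all diagonals between two that it meets, and to cross between neighbouring
    ones by adjacent boxes. *)
Lemma border_strip_ribbon S : border_strip S -> exists l, ribbon l #|S| S.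
Proof.
case/and4P=> /set0Pn[x0 x0S] /skew_shape_convex convS conS no_sq.
have injS : {in S &, injective dg}.
  suff lt_contra x y : x \in S -> y \in S -> dg x = dg y -> pos y < pos x -> False.
    move=> x y xS yS eq_d; case: (ltngtP (pos x) (pos y)) => [lt_p | lt_p | eq_p].
    - by case: (lt_contra y x).
    - by case: (lt_contra x y).
    by apply: box_eq.
  move=> xS yS eq_d lt_p; case/negP: no_sq.
  have lt1 : x.1.+1 < r by have := ltn_ord y.1; move: lt_p; rewrite /pos; lia.
  have lt2 : x.2.+1 < c by have := ltn_ord y.2; move: lt_p eq_d; rewrite /dg /pos; lia.
  have le1 : x.1 < y.1 by move: lt_p; rewrite /pos; lia.
  have le2 : x.2 < y.2 by move: lt_p eq_d; rewrite /dg /pos; lia.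
  apply/existsP; exists x; apply/existsP; exists (Ordinal lt1, Ordinal lt2).
  have sq (u : box r c) : x.1 <= u.1 <= y.1 -> x.2 <= u.2 <= y.2 -> u \in S by apply: convS.
  by rewrite /= !eqxx xS !sq //=; lia.
have con x y : x \in S -> y \in S ->
    connect [rel u v | [&& u \in S, v \in S & adjacent u v]] x y.
  by move=> xS yS; have /forall_inP/(_ x xS)/forall_inP := conS; apply.
have cross x y d : x \in S -> y \in S -> dg x <= d < dg y ->
    exists u v, [/\ u \in S, v \in S, adjacent u v, dg u = d & dg v = d.+1].
  move=> xS yS d_xy.
  have [|u [v [/and3P[uS vS uv] Du Dv]]] := connect_crossing _ (con x y xS yS) d_xy.
    by move=> u v /= /and3P[_ _ /adjacent_dg]; lia.
  by exists u, v.
case: (arg_minnP dg x0S) => x xS min_x; exists (dg x).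
apply/ribbonP; split=> // [y yS|u v uS vS Dv].
  rewrite min_x //= ltnNge; apply/negP=> le_y.
  (* A box further away would make [S] meet at least [#|S| + 1] diagonals. *)
  have: #|S| < size [seq dg z | z <- enum S].
    apply: leq_trans (uniq_leq_size (iota_uniq (dg x) (#|S|).+1) _); first by rewrite size_iota.
    move=> d; rewrite mem_iota addnS ltnS => /andP[le_xd le_d].
    apply/mapP; case: d le_xd le_d => [|d] le_xd le_d.
      by exists x; [rewrite mem_enum | apply/esym/eqP; rewrite -leqn0].
    move: le_xd; rewrite leq_eqVlt => /orP[/eqP <- | lt_xd]; first by exists x; rewrite ?mem_enum.
    have [|u [v [_ vS _ _ Dv]]] := cross x y d xS yS.
      by rewrite -ltnS lt_xd; apply: leq_trans le_d le_y.
    by exists v; rewrite ?mem_enum.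
  by rewrite size_map -cardE ltnn.
have [|u' [v' [u'S v'S adj Du' Dv']]] := cross u v (dg u) uS vS; first by rewrite Dv leqnn ltnSn.
by rewrite -(injS _ _ u'S uS Du') -(injS _ _ v'S vS) // Dv' Dv.
Qed.

(** A 2 x 2 square has two corners on one diagonal, which a ribbon excludes. *)
Lemma ribbon_border_strip l k S : 0 < k -> ribbon l k S -> border_strip S /\ #|S| = k.
Proof.
move=> k_gt0 rib; have /ribbonP[cS lS iS aS] := rib; split=> //.
apply/and4P; split; first by rewrite -card_gt0 cS.
- by apply: convex_skew_shape => x y z; apply: ribbon_convex rib.
- have e_sym : connect_sym [rel u v | [&& u \in S, v \in S & adjacent u v]].
    by apply: sym_connect_sym => u v /=; rewrite adjacent_sym andbCA.
  suff con m x y : x \in S -> y \in S -> dg y = dg x + m ->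
      connect [rel u v | [&& u \in S, v \in S & adjacent u v]] x y.
    apply/forall_inP=> x xS; apply/forall_inP=> y yS.
    case: (leqP (dg x) (dg y)) => [le_xy | /ltnW le_yx].
      by apply: (con (dg y - dg x)); rewrite // subnKC.
    by rewrite e_sym; apply: (con (dg x - dg y)); rewrite // subnKC.
  elim: m x => [|m IHm] x xS yS Dy; first by rewrite (iS x y) // Dy addn0.
  have [|z zS Dz] := ribbon_diag (d := (dg x).+1) rib.
    by have [? ?] := (lS x xS, lS y yS); lia.
  apply: connect_trans (IHm z zS yS _); last by lia.
  by apply: connect1; rewrite /= xS zS aS.
apply/existsP=> [[x /existsP[y /and5P[/eqP y1 /eqP y2 xS _ /andP[_ yS]]]]].
suff Exy : x = y by move: y1; rewrite Exy; lia.
by apply: iS => //; have := ltn_ord y.1; rewrite /dg /pos y1 y2; lia.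
Qed.

End Ribbons.

(** * Positions on consecutive diagonals *)

Section StateCore.
Local Open Scope nat_scope.

Lemma count_step (U1 U2 : seq nat) k : size U1 = size U2 ->
    all (fun z => (z.2 == z.1) || (z.2 == z.1.+1)) (zip U1 U2) ->
  count (fun x => x < k) U1 =
    count (fun x => x < k) U2 + count (fun z => z.1 < k <= z.2) (zip U1 U2).
Proof.
elim: U1 U2 => [|x1 U1 IHU] [|x2 U2] //= [/IHU{}IHU] /andP[step /IHU->].
by move: step; lia.
Qed.

Lemma count_perm_iota n (V : seq nat) k : perm_eq V (iota 0 n) ->
  count (fun x => x < k) V = minn k n.
Proof.
move=> /permP->; elim: n => [|n IHn]; first by rewrite minn0.
by rewrite -addn1 iotaD count_cat IHn /=; lia.
Qed.

(* Tiles crossing two consecutive diagonals move by at most one position: the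
   number of entries below each threshold then determines who moves. *)
Lemma state_step_next n (V1 V2 : seq nat) :
    0 < n -> perm_eq V1 (iota 0 n) -> perm_eq V2 (iota 0 n) ->
    (forall i, i < n.-1 -> nth 0 V2 i = nth 0 V1 i.+1 \/ nth 0 V2 i = (nth 0 V1 i.+1).+1) ->
  V2 = next (last 0 V2) V1 /\ last 0 V2 <= head 0 V1.
Proof.
move=> n_gt0 V1n V2n step.
have cnt k := etrans (count_perm_iota k V1n) (esym (count_perm_iota k V2n)).
have sz1 : size V1 = n by rewrite (perm_size V1n) size_iota.
have sz2 : size V2 = n by rewrite (perm_size V2n) size_iota.
case: V1 V1n sz1 step cnt => [|p U1] V1n sz1 step cnt; first by rewrite -sz1 in n_gt0.
case/lastP: V2 V2n sz2 step cnt => [|U2 q] V2n sz2 step cnt; first by rewrite -sz2 in n_gt0.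
rewrite last_rcons /next /=.
move: sz1 sz2; rewrite size_rcons /= => sz1 sz2.
have szU : size U1 = size U2 by lia.
have szZ : size (zip U1 U2) = size U1 by rewrite size1_zip ?szU.
have stepU i : i < size U1 -> nth 0 U2 i = nth 0 U1 i \/ nth 0 U2 i = (nth 0 U1 i).+1.
  move=> lt_i; have := step i; rewrite nth_rcons -szU lt_i /=; apply; lia.
have stepZ : all (fun z => (z.2 == z.1) || (z.2 == z.1.+1)) (zip U1 U2).
  apply/(all_nthP (0, 0)) => i; rewrite szZ nth_zip // => /stepU /=.
  by case=> ->; rewrite eqxx ?orbT.
(* Exactly one strip crosses the threshold [k] when [q < k <= p], and none otherwise. *)
have cntU k : count (fun z => z.1 < k <= z.2) (zip U1 U2) + (p < k) = (q < k).
  have := cnt k; rewrite -cats1 count_cat /= (count_step k szU stepZ); lia.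
have U1_uniq : uniq U1 by have := perm_uniq V1n; rewrite iota_uniq => /andP[].
split; last by have := cntU p.+1; lia.
congr (rcons _ q); apply: (@eq_from_nth _ 0) => [|i]; rewrite ?size_map -szU // => lt_i.
rewrite (nth_map 0) // /shift; set x := nth 0 U1 i.
have := cntU x.+1; case: (stepU i lt_i) => Di.
  have [lt_x|] := boolP (q <= x < p); last by rewrite Di -/x; lia.
  have -> : q < x.+1 by lia.
  have -> : p < x.+1 = false by lia.
  (* The strip that crosses [x.+1] starts from [x], so it is the one at index [i], which was assumed
     to stay. *)
  rewrite addn0 => cnt1; have /hasP[] : has (fun z => z.1 < x.+1 <= z.2) (zip U1 U2).
    by rewrite has_count cnt1.
  move=> z /(nthP (0, 0))[j]; rewrite szZ => lt_j <-; rewrite nth_zip //= => Dj.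
  suff Eij : i = j by move: Dj; rewrite -Eij Di; lia.
  have Ej : nth 0 U1 j = x by case: (stepU j lt_j) => E; move: Dj; rewrite E; lia.
  by apply/eqP; rewrite -(nth_uniq 0 lt_i lt_j U1_uniq) Ej.
suff : 0 < count (fun z => z.1 < x.+1 <= z.2) (zip U1 U2) by rewrite Di -/x; lia.
rewrite -has_count; apply/hasP; exists (nth (0, 0) (zip U1 U2) i); first by rewrite mem_nth ?szZ.
by rewrite nth_zip //= Di -/x; lia.
Qed.

End StateCore.

(** * Decompositions and their codes *)

Section Decomposition.
Local Open Scope nat_scope.
Variable n : nat.
Hypothesis n_gt0 : 0 < n.
Local Notation B := (box n (2 * n)).
Implicit Types (x y : B) (S : {set B}) (P : {set {set B}}).

Lemma dg_bound x : dg x < (3 * n).-1.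
Proof. by have := dg_lt x; have := pos_lt x; lia. Qed.

Lemma card_diag d : d < 2 * n -> #|[set x : B | dg x == d]| = minn d.+1 n.
Proof.
move=> lt_d; have map_uniq : uniq [seq pos x | x <- enum [set x : B | dg x == d]].
  rewrite map_inj_in_uniq ?enum_uniq // => x y.
  by rewrite !mem_enum !inE => /eqP Dx /eqP Dy /box_eq; apply; rewrite Dx.
rewrite cardE -(size_map (@pos n (2 * n))) -[RHS](size_iota 0).
apply: perm_size; apply: uniq_perm; rewrite ?iota_uniq // => p.
rewrite mem_iota; apply/mapP/idP => [[x] | lt_p].
  by rewrite mem_enum inE => /eqP Dx ->; have := pos_le_dg x; have := pos_lt x; lia.
have [||x [Dp Dx]] := @ex_box n (2 * n) p d; try lia.
by exists x; rewrite ?mem_enum ?inE ?Dx.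
Qed.

Lemma ribbon_level_lt l S : ribbon l n S -> l < 2 * n.
Proof.
move=> rib; have [|x xS Dx] := ribbon_diag (d := l + n.-1) rib; first by lia.
by have := dg_bound x; lia.
Qed.

Definition level S : nat := odflt 0 (omap (@nat_of_ord _) [pick l : 'I_(2 * n) | ribbon l n S]).

Lemma level_ribbon l S : ribbon l n S -> level S = l.
Proof.
move=> rib; rewrite /level; case: pickP => [l' rib' | /(_ (Ordinal (ribbon_level_lt rib)))].
  exact: ribbon_level rib' rib.
by rewrite rib.
Qed.

Section Tiles.
Variable P : {set {set B}}.
Hypothesis P_BSD : P \in BSD n (2 * n) n.

Lemma tile_ribbon S : S \in P -> ribbon (level S) n S.
Proof.
move=> SP; move: P_BSD; rewrite inE => /andP[_ /forall_inP/(_ S SP)/andP[strip /eqP cS]].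
by have [l] := border_strip_ribbon strip; rewrite cS => rib; rewrite (level_ribbon rib).
Qed.

Lemma tile_partition : partition P [set: B].
Proof. by move: P_BSD; rewrite inE => /andP[]. Qed.

Lemma tile_eq S1 S2 x : S1 \in P -> S2 \in P -> x \in S1 -> x \in S2 -> S1 = S2.
Proof.
have /and3P[_ tiP _] := tile_partition => S1P S2P xS1 xS2.
by rewrite -(def_pblock tiP S1P xS1) -(def_pblock tiP S2P xS2).
Qed.

(** Each box of the diagonal lies in one tile, and a tile has at most one box there. *)
Lemma card_tiles_through d : d < 2 * n ->
  #|[set S in P | d.+1 - n <= level S < d.+1]| = minn d.+1 n.
Proof.
move=> lt_d; rewrite -(card_diag lt_d).
have /and3P[/eqP covP tiP _] := tile_partition.
have pbP x : pblock P x \in P by rewrite pblock_mem // covP inE.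
have pbx x : x \in pblock P x by rewrite mem_pblock covP inE.
rewrite -(card_in_imset (f := pblock P)) => [|x y]; last first.
  rewrite !inE => /eqP Dx /eqP Dy eq_pb; have /ribbonP[_ _ inj _] := tile_ribbon (pbP x).
  by apply: inj; rewrite ?Dx ?Dy // eq_pb.
apply: eq_card => S; rewrite !inE; apply/andP/imsetP=> [[SP lev_S] | [x]].
  have [|x xS Dx] := ribbon_diag (d := d) (tile_ribbon SP); first by lia.
  by exists x; rewrite ?inE ?Dx // (def_pblock tiP SP xS).
rewrite inE => /eqP Dx ->; split=> //.
by have /ribbonP[_ /(_ x (pbx x)) + _ _] := tile_ribbon (pbP x); lia.
Qed.

(** The tiles starting by the diagonal [d] either have ended before it, and are counted by
    induction, or cross it: (d + 1 - n) + min(d + 1, n) = d + 1, with truncated subtraction. *)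
Lemma card_tiles_below d : d <= 2 * n -> #|[set S in P | level S < d]| = d.
Proof.
have [m] := ubnP d; elim: m d => // m IHm [|d] lt_m le_d.
  by apply: eq_card0 => S; rewrite !inE ltn0 andbF.
have -> : [set S in P | level S < d.+1] = [set S in P | level S < d.+1 - n]
    :|: [set S in P | d.+1 - n <= level S < d.+1].
  by apply/setP=> S; rewrite !inE -andb_orr; congr (_ && _); lia.
rewrite cardsU disjoint_setI0 ?cards0 ?subn0.
  by rewrite card_tiles_through // IHm; lia.
rewrite disjoint_subset; apply/subsetP=> S; rewrite !inE => /andP[_ lt_S].
by rewrite negb_and; apply/orP; right; lia.
Qed.

Lemma tile_of_level l : l < 2 * n -> exists S, [/\ S \in P, ribbon l n S &
  forall S', S' \in P -> ribbon l n S' -> S' = S].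
Proof.
move=> lt_l.
have : #|[set S in P | level S == l]| == 1.
  rewrite -(eqn_add2l #|[set S in P | level S < l]|) -cardsUI.
  rewrite [X in _ + #|pred_of_set X|](_ : _ = set0); last first.
    by apply/setP=> S; rewrite !inE; case: ltngtP; rewrite ?andbF.
  rewrite cards0 addn0 card_tiles_below ?(ltnW lt_l) // addn1 -[X in _ == X]card_tiles_below //.
  apply/eqP; apply: eq_card => S; rewrite !inE -andb_orr ltnS [in RHS]leq_eqVlt orbC.
  by [].
case/cards1P=> S DS; exists S.
have : S \in [set S in P | level S == l] by rewrite DS set11.
rewrite inE => /andP[SP /eqP lev_S]; split=> // [|S' S'P rib'].
  by rewrite -lev_S tile_ribbon.
by apply/set1P; rewrite -DS inE S'P (level_ribbon rib') eqxx.
Qed.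

End Tiles.

Definition tile_pos P l d : nat :=
  if [pick x : B | (dg x == d) && [exists S in P, ribbon l n S && (x \in S)]] is Some x
  then pos x else 0.

Lemma tile_posE P l S x : P \in BSD n (2 * n) n -> S \in P -> ribbon l n S -> x \in S ->
  tile_pos P l (dg x) = pos x.
Proof.
move=> P_BSD SP rib xS; rewrite /tile_pos; case: pickP => [y | /(_ x)]; last first.
  by rewrite eqxx /= => /exists_inP[]; exists S; rewrite ?rib.
case/andP=> /eqP Dy /exists_inP[S' S'P /andP[rib' yS']].
have [S0 [_ _ S0_eq]] := tile_of_level P_BSD (ribbon_level_lt rib).
have /ribbonP[_ _ inj _] := rib.
by rewrite (inj y x) // (S0_eq S) // -(S0_eq S').
Qed.

Definition tiling_state P d : seq nat :=
  mkseq (fun i => if (n.-1 <= d + i) && ((d + i).+1 < 3 * n)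
                  then tile_pos P (d + i - n.-1) d else n.-1 - i) n.

Lemma nth_tiling_state P d i : i < n -> nth 0 (tiling_state P d) i =
  if (n.-1 <= d + i) && ((d + i).+1 < 3 * n) then tile_pos P (d + i - n.-1) d else n.-1 - i.
Proof. by move=> lt_i; rewrite nth_mkseq. Qed.

Lemma nth_tiling_state_tile P d i : P \in BSD n (2 * n) n -> i < n -> n.-1 <= d + i ->
  (d + i).+1 < 3 * n -> exists S x, [/\ S \in P, ribbon (d + i - n.-1) n S, x \in S, dg x = d
    & nth 0 (tiling_state P d) i = pos x].
Proof.
move=> P_BSD lt_i le_di lt_di; rewrite nth_tiling_state // le_di lt_di /=.
have [|S [SP rib _]] := tile_of_level P_BSD (l := d + i - n.-1); first by lia.
have [|x xS Dx] := ribbon_diag (d := d) rib; first by lia.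
by exists S, x; split=> //; rewrite -{2}Dx (tile_posE P_BSD SP).
Qed.

Lemma perm_tiling_state P d : P \in BSD n (2 * n) n -> perm_eq (tiling_state P d) (iota 0 n).
Proof.
move=> P_BSD; rewrite perm_iotaE size_mkseq eqxx /=.
(* These bounds separate tiles from outside entries, whose positions exceed [d] on the left and are
   at most [d - 2 * n] on the right. *)
have real i : i < n -> n.-1 <= d + i -> (d + i).+1 < 3 * n ->
    [/\ nth 0 (tiling_state P d) i < n, nth 0 (tiling_state P d) i <= d
      & d < 2 * n + nth 0 (tiling_state P d) i].
  move=> lt_i le_di lt_di.
  have [S [x [_ _ _ <- ->]]] := nth_tiling_state_tile P_BSD lt_i le_di lt_di.
  by rewrite pos_lt pos_le_dg dg_lt.
have phant i : i < n -> (d + i < n.-1) || (3 * n <= (d + i).+1) ->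
    nth 0 (tiling_state P d) i = n.-1 - i.
  by move=> lt_i ph; rewrite nth_tiling_state // ifF //; lia.
apply/andP; split.
  suff lt_neq i j : i < j < n -> nth 0 (tiling_state P d) i != nth 0 (tiling_state P d) j.
    apply/(uniqP 0) => i j; rewrite !inE size_mkseq => lt_i lt_j eq_ij.
    case: (ltngtP i j) => // [lt_ij | lt_ji].
      by have := lt_neq i j; rewrite eq_ij eqxx lt_ij lt_j => /(_ isT).
    by have := lt_neq j i; rewrite eq_ij eqxx lt_ji lt_i => /(_ isT).
  case/andP=> lt_ij lt_j; have lt_i := ltn_trans lt_ij lt_j.
  have [pj | rj] := boolP ((d + j < n.-1) || (3 * n <= (d + j).+1)).
    have [pi | ri] := boolP ((d + i < n.-1) || (3 * n <= (d + i).+1)).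
      by rewrite (phant i lt_i pi) (phant j lt_j pj); lia.
    rewrite (phant j lt_j pj); have [||_ le1 lt2] := real i lt_i; lia.
  have [pi | ri] := boolP ((d + i < n.-1) || (3 * n <= (d + i).+1)).
    rewrite (phant i lt_i pi); have [||_ le1 lt2] := real j lt_j; lia.
  have [|| S [x [SP rib xS Dx ->]]] := nth_tiling_state_tile P_BSD lt_i (d := d); try lia.
  have [|| S' [x' [S'P rib' x'S' Dx' ->]]] := nth_tiling_state_tile P_BSD lt_j (d := d); try lia.
  apply/eqP=> eq_pos; have Exx' : x = x' by apply: box_eq; rewrite ?Dx.
  have ESS' := tile_eq P_BSD SP S'P xS; rewrite Exx' in ESS'; rewrite ESS' // in rib.
  by have := ribbon_level n_gt0 rib rib'; lia.
apply/(all_nthP 0) => i; rewrite size_mkseq => lt_i.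
have [p_i | r_i] := boolP ((d + i < n.-1) || (3 * n <= (d + i).+1)).
  by rewrite phant //; lia.
by have [||] := real i lt_i; lia.
Qed.

(** The index [i] on the diagonal [d.+1] and [i.+1] on [d] denote the same tile, whose adjacent
    boxes keep the position or raise it by one; [state_step_next] applies. *)
Lemma tiling_state_next P d : P \in BSD n (2 * n) n ->
  tiling_state P d.+1 = next (last 0 (tiling_state P d.+1)) (tiling_state P d) /\
  last 0 (tiling_state P d.+1) <= head 0 (tiling_state P d).
Proof.
move=> P_BSD; apply: (@state_step_next n); rewrite ?perm_tiling_state // => i lt_i.
have [p_i | r_i] := boolP ((d.+1 + i < n.-1) || (3 * n <= (d.+1 + i).+1)).
  by rewrite !nth_tiling_state ?ifF; lia.
have [||| S [x [SP rib xS Dx ->]]] := @nth_tiling_state_tile P d.+1 i P_BSD; try lia.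
have [||| S' [x' [S'P rib' x'S' Dx' ->]]] := @nth_tiling_state_tile P d i.+1 P_BSD; try lia.
have [|S0 [_ _ S0_eq]] := tile_of_level P_BSD (l := d.+1 + i - n.-1); first by lia.
have /ribbonP[_ _ _ adj] := rib.
have x'S : x' \in S by rewrite (S0_eq S) // -(S0_eq S') // addSnnS.
have Dxx' : dg x = (dg x').+1 by rewrite Dx Dx'.
by have := adj x' x x'S xS Dxx'; rewrite adjacent_up // => /orP[] /eqP; [left | right].
Qed.

Lemma tiling_state0 P : P \in BSD n (2 * n) n -> tiling_state P 0 = start n.
Proof.
move=> P_BSD; apply: (@eq_from_nth _ 0) => [|i]; rewrite size_mkseq.
  by rewrite size_rev size_iota.
move=> lt_i; rewrite nth_rev ?size_iota // nth_iota; last by lia.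
have [Di | ne_i] := eqVneq i n.-1; last by rewrite nth_tiling_state // ifF; lia.
have [|| S [x [_ _ _ Dx ->]]] := nth_tiling_state_tile P_BSD lt_i (d := 0); try lia.
by have := pos_le_dg x; lia.
Qed.

(** The last entry on a diagonal is the strip that starts there. The diagonal 0 has a single box, so
    the code begins at 1. *)
Definition tiling_code P : seq nat :=
  [seq last 0 (tiling_state P d) | d <- iota 1 (2 * n).-1].

(* The last n - 1 steps insert tiles lying outside of the rectangle. *)
Definition code_state (c : seq nat) d := run (start n) (take d (c ++ nseq n.-1 0)).

Lemma code_stateS c d : d < size c + n.-1 ->
  code_state c d.+1 = next (nth 0 (c ++ nseq n.-1 0) d) (code_state c d).
Proof.
move=> lt_d; rewrite /code_state (take_nth 0) ?size_cat ?size_nseq //.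
exact: run_rcons.
Qed.

Lemma last_tiling_state P d : last 0 (tiling_state P d) = nth 0 (tiling_state P d) n.-1.
Proof. by rewrite (last_nth 0) size_mkseq; case: (n) n_gt0. Qed.

Lemma code_state_tiling P d : P \in BSD n (2 * n) n -> d < (3 * n).-1 ->
  code_state (tiling_code P) d = tiling_state P d.
Proof.
move=> P_BSD; elim: d => [|d IHd] lt_d; first by rewrite tiling_state0 // /code_state take0.
have sz : size (tiling_code P) = (2 * n).-1 by rewrite size_map size_iota.
rewrite code_stateS ?sz ?IHd; try lia.
have [eq_next _] := tiling_state_next d P_BSD; rewrite [in RHS]eq_next; congr next.
rewrite nth_cat sz; case: ltnP => lt_dn.
  by rewrite (nth_map 0) ?size_iota // nth_iota.
rewrite nth_nseq if_same last_tiling_state nth_tiling_state ?ifF; lia.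
Qed.

Lemma tiling_code_codes P : P \in BSD n (2 * n) n ->
  tiling_code P \in codes (2 * n).-1 1 (start n).
Proof.
move=> P_BSD; have sz : size (tiling_code P) = (2 * n).-1 by rewrite size_map size_iota.
apply/codesP; split=> // k lt_k.
have -> : run (start n) (take k (tiling_code P)) = tiling_state P k.
  by rewrite -code_state_tiling //; [rewrite /code_state takel_cat // sz ltnW | lia].
rewrite (nth_map 0) ?size_iota // nth_iota // leq_min add1n.
have [_ ->] := tiling_state_next k P_BSD; rewrite andbT last_tiling_state.
have [||| S [x [_ _ _ Dx ->]]] := @nth_tiling_state_tile P k.+1 n.-1 P_BSD; try lia.
by rewrite -Dx pos_le_dg.
Qed.

Definition strip (V : nat -> seq nat) l : {set B} :=
  [set x : B | (l <= dg x < l + n) && (pos x == nth 0 (V (dg x)) (l + n.-1 - dg x))].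

Definition tiling V : {set {set B}} := [set strip V l | l : 'I_(2 * n)].

Lemma eq_tiling V1 V2 : (forall d, d < (3 * n).-1 -> V1 d = V2 d) -> tiling V1 = tiling V2.
Proof.
move=> eqV; apply: eq_imset => l; apply/setP=> x.
by rewrite !inE eqV // dg_bound.
Qed.

Lemma strip_tiling_state P l S : P \in BSD n (2 * n) n -> S \in P -> ribbon l n S ->
  strip (tiling_state P) l = S.
Proof.
move=> P_BSD SP rib; have lt_l := ribbon_level_lt rib; have /ribbonP[_ lS _ _] := rib.
have nthE d : l <= d < l + n ->
    nth 0 (tiling_state P d) (l + n.-1 - d) = tile_pos P l d.
  move=> d_l; rewrite nth_tiling_state; last by lia.
  by rewrite ifT; [congr tile_pos; lia | lia].
apply/setP=> x; rewrite inE; apply/andP/idP => [[d_l] | xS]; last first.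
  by rewrite lS // nthE ?lS // (tile_posE P_BSD SP).
rewrite nthE // => /eqP Dp; have [y yS Dy] := ribbon_diag rib d_l.
suff -> : x = y by [].
by apply: box_eq; rewrite ?Dy // Dp -Dy (tile_posE P_BSD SP).
Qed.

Lemma tiling_tiling_state P : P \in BSD n (2 * n) n -> tiling (tiling_state P) = P.
Proof.
move=> P_BSD; apply/setP=> S; apply/imsetP/idP => [[l _ ->] | SP].
  have [S' [S'P rib _]] := tile_of_level P_BSD (ltn_ord l).
  by rewrite (strip_tiling_state P_BSD S'P rib).
have rib := tile_ribbon P_BSD SP; exists (Ordinal (ribbon_level_lt rib)) => //.
by rewrite /= (strip_tiling_state P_BSD SP).
Qed.

Lemma tiling_code_inj : {in BSD n (2 * n) n &, injective tiling_code}.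
Proof.
move=> P1 P2 P1_BSD P2_BSD eq_code.
rewrite -(tiling_tiling_state P1_BSD) -(tiling_tiling_state P2_BSD).
by apply: eq_tiling => d lt_d; rewrite -!code_state_tiling // eq_code.
Qed.

(** * The decomposition with a given code *)

Section TilingOfCode.
Variable c : seq nat.
Hypothesis c_code : c \in codes (2 * n).-1 1 (start n).
Local Notation V := (code_state c).
Local Notation code d := (nth 0 (c ++ nseq n.-1 0) d).

Lemma size_code : size c = (2 * n).-1.
Proof. by have /codesP[] := c_code. Qed.

Lemma nth_code_out d : (2 * n).-1 <= d -> code d = 0.
Proof. by move=> le_d; rewrite nth_cat size_code ltnNge le_d nth_nseq if_same. Qed.

Lemma code_le d : d < (3 * n).-2 -> code d <= minn d.+1 (head 0 (V d)).
Proof.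
move=> lt_d; have [lt_dn | le_nd] := ltnP d (2 * n).-1; last by rewrite nth_code_out.
have /codesP[sz_c /(_ d lt_dn)] := c_code.
by rewrite nth_cat sz_c lt_dn /code_state takel_cat ?sz_c ?(ltnW lt_dn).
Qed.

Lemma state_code d : d < (3 * n).-1 -> state n d (V d).
Proof.
move=> lt_d; rewrite -[d in state n d _]add0n; apply: state_run => //.
- exact: state_start.
- apply/codesP; split; first by rewrite size_takel // size_cat size_nseq size_code; lia.
  move=> k lt_k; rewrite nth_take // take_takel; last by lia.
  by rewrite add1n; apply: code_le; lia.
by move=> k lt_k le_k; rewrite nth_take // nth_code_out //; lia.
Qed.

Lemma size_code_state d : d < (3 * n).-1 -> size (V d) = n.
Proof. by case/state_code=> V_n _; rewrite (perm_size V_n) size_iota. Qed.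

Lemma uniq_code_state d : d < (3 * n).-1 -> uniq (V d).
Proof. by case/state_code=> V_n _; rewrite (perm_uniq V_n) iota_uniq. Qed.

Lemma code_state_box l d : l < 2 * n -> l <= d < l + n ->
  exists x : B, pos x = nth 0 (V d) (l + n.-1 - d) /\ dg x = d.
Proof.
move=> lt_l l_d; have lt_d : d < (3 * n).-1 by lia.
have [V_n phant] := state_code lt_d; have sz := size_code_state lt_d.
set i := l + n.-1 - d; set p := nth 0 (V d) i; have lt_i : i < n by lia.
have lt_p : p < n.
  by have := V_n; rewrite perm_iotaE => /and3P[_ _ /(all_nthP 0)]; apply; rewrite sz.
apply: ex_box => //; have lt_j : n.-1 - p < n by lia.
(* Otherwise the outside entry of index [n.-1 - p] would also have position [p]. The negation says
   exactly that the diagonal [d] has a box at [p]. *)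
have not_phant : ~~ ((d + (n.-1 - p) < n.-1) || (3 * n <= (d + (n.-1 - p)).+1)).
  apply/negP=> ph; have := phant _ lt_j ph; rewrite subKn; last by lia.
  move/eqP; rewrite nth_uniq ?sz ?uniq_code_state // => /eqP; lia.
by lia.
Qed.

Lemma ribbon_strip l : l < 2 * n -> ribbon l n (strip V l).
Proof.
move=> lt_l; have injS : {in strip V l &, injective (@dg n (2 * n))}.
  move=> x y; rewrite !inE => /andP[_ /eqP px] /andP[_ /eqP py] eq_d.
  by apply: box_eq; rewrite // px py eq_d.
apply/ribbonP; split=> // [|x|x y]; last 2 first.
- by rewrite inE => /andP[].
- rewrite !inE => /andP[lx /eqP px] /andP[ly /eqP py] Dy; rewrite adjacent_up // px py Dy.
  have lt_d := dg_bound y; rewrite Dy in lt_d ly.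
  rewrite code_stateS ?size_code; last by lia.
  rewrite (nth_next _ (size_code_state (dg_bound x))); try lia.
  have -> : (l + n.-1 - (dg x).+1).+1 = l + n.-1 - dg x by lia.
  by rewrite ifF /shift; lia.
have map_uniq : uniq [seq dg x | x <- enum (strip V l)].
  by rewrite map_inj_in_uniq ?enum_uniq // => x y; rewrite !mem_enum; apply: injS.
rewrite cardE -(size_map (@dg n (2 * n))) -[RHS](size_iota l).
apply: perm_size; apply: uniq_perm; rewrite ?iota_uniq // => d.
rewrite mem_iota; apply/mapP/idP => [[x] | l_d].
  by rewrite mem_enum inE => /andP[l_x _] ->.
have [x [px Dx]] := code_state_box lt_l l_d.
by exists x; rewrite ?mem_enum ?inE ?Dx ?l_d ?px ?eqxx.
Qed.

Lemma strip_disjoint l1 l2 x : l1 < 2 * n -> l2 < 2 * n ->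
  x \in strip V l1 -> x \in strip V l2 -> l1 = l2.
Proof.
move=> lt1 lt2; rewrite !inE => /andP[l1x /eqP->] /andP[l2x].
have lt_d := dg_bound x.
rewrite nth_uniq ?size_code_state ?uniq_code_state //; lia.
Qed.

(** The state is a permutation, so some entry holds the position of [x]; it is not an outside one,
    since those positions have no box on this diagonal. *)
Lemma strip_cover x : exists2 l, l < 2 * n & x \in strip V l.
Proof.
have lt_d := dg_bound x; have [V_n phant] := state_code lt_d.
have pV : pos x \in V (dg x) by rewrite (perm_mem V_n) mem_iota pos_lt.
set i := index (pos x) (V (dg x)).
have lt_i : i < n by rewrite -(size_code_state lt_d) index_mem.
have Dp : nth 0 (V (dg x)) i = pos x by apply: nth_index.
have not_phant : ~~ ((dg x + i < n.-1) || (3 * n <= (dg x + i).+1)).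
  apply/negP=> ph; have := phant i lt_i ph; rewrite Dp.
  by have := (pos_le_dg x); have := dg_lt x; lia.
exists (dg x + i - n.-1); first by lia.
rewrite inE; apply/andP; split; first by lia.
by rewrite -Dp; apply/eqP; congr nth; lia.
Qed.

Lemma tiling_BSD : tiling V \in BSD n (2 * n) n.
Proof.
rewrite inE; apply/andP; split; last first.
  apply/forall_inP=> _ /imsetP[l _ ->].
  by have [-> ->] := ribbon_border_strip n_gt0 (ribbon_strip (ltn_ord l)); rewrite eqxx.
apply/and3P; split.
- apply/eqP/setP=> x; rewrite inE; apply/bigcupP.
  have [l lt_l xl] := strip_cover x; exists (strip V l) => //.
  by apply/imsetP; exists (Ordinal lt_l).
- apply/trivIsetP=> _ _ /imsetP[l1 _ ->] /imsetP[l2 _ ->] neq.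
  rewrite -setI_eq0; apply: contraNT neq => /set0Pn[x]; rewrite inE => /andP[x1 x2].
  by rewrite (strip_disjoint (ltn_ord l1) (ltn_ord l2) x1 x2).
apply/imsetP=> [[l _ eq0]]; have /ribbonP[cS _ _ _] := ribbon_strip (ltn_ord l).
by rewrite -eq0 cards0 in cS; lia.
Qed.

Lemma tiling_codeK : tiling_code (tiling V) = c.
Proof.
apply: (@eq_from_nth _ 0); rewrite size_map size_iota ?size_code // => k lt_k.
rewrite (nth_map 0) ?size_iota // nth_iota // add1n last_tiling_state.
have P_BSD := tiling_BSD.
have lt_k1 : k.+1 < 2 * n by lia.
have rib := ribbon_strip lt_k1.
have SP : strip V k.+1 \in tiling V by apply/imsetP; exists (Ordinal lt_k1).
have [|x xS Dx] := ribbon_diag (d := k.+1) rib; first by lia.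
rewrite nth_tiling_state; last by lia.
rewrite ifT; last by lia.
rewrite addnK -{2}Dx (tile_posE P_BSD SP rib xS).
move: xS; rewrite inE => /andP[_ /eqP->]; rewrite Dx addKn.
rewrite code_stateS ?size_code; last by lia.
have lt_k3 : k < (3 * n).-1 by lia.
rewrite (nth_next _ (size_code_state lt_k3)) ?eqxx; try lia.
by rewrite nth_cat size_code lt_k.
Qed.

End TilingOfCode.

(** A decomposition is recovered from its states, which its code determines, and every code is that
    of the tiling it generates. *)
Lemma card_BSD_codes : #|BSD n (2 * n) n| = size (codes (2 * n).-1 1 (start n)).
Proof.
rewrite cardE -(size_map tiling_code); apply: perm_size; apply: uniq_perm.
- rewrite map_inj_in_uniq ?enum_uniq // => P1 P2; rewrite !mem_enum.
  exact: tiling_code_inj.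
- exact: codes_uniq.
move=> c; apply/mapP/idP => [[P] | c_code].
  by rewrite mem_enum => P_BSD ->; apply: tiling_code_codes.
exists (tiling (code_state c)); last by rewrite tiling_codeK.
by rewrite mem_enum tiling_BSD.
Qed.

End Decomposition.

(** * Transposing the rectangle *)

Section Transposition.
Local Open Scope nat_scope.

Definition flip r c (x : box r c) : box c r := (x.2, x.1).

Definition flip_set r c (S : {set box r c}) : {set box c r} := [set x | flip x \in S].

Lemma flipK r c : cancel (@flip r c) (@flip c r).
Proof. by case. Qed.

Lemma flip_setK r c : cancel (@flip_set r c) (@flip_set c r).
Proof. by move=> S; apply/setP=> x; rewrite !inE flipK. Qed.

Lemma flip_set_imset r c (S : {set box r c}) : flip_set S = [set flip x | x in S].
Proof.
apply/setP=> x; rewrite inE; apply/idP/imsetP => [xS | [y yS ->]]; last by rewrite flipK.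
by exists (flip x); rewrite ?flipK.
Qed.

Lemma card_flip_set r c (S : {set box r c}) : #|flip_set S| = #|S|.
Proof. by rewrite flip_set_imset card_imset //; apply: can_inj (@flipK r c). Qed.

Lemma adjacent_flip r c (x y : box r c) : adjacent (flip x) (flip y) = adjacent x y.
Proof. by rewrite /adjacent /= orbC. Qed.

(** Skew shapes pass through convexity, which is symmetric in rows and columns. *)
Lemma flip_border_strip r c (S : {set box r c}) : border_strip S -> border_strip (flip_set S).
Proof.
case/and4P=> S0 /skew_shape_convex convS conS no_sq; apply/and4P; split.
- by rewrite -card_gt0 card_flip_set card_gt0.
- by apply: convex_skew_shape => x y z; rewrite !inE => xS zS y1 y2; apply: convS xS zS _ _.
- apply/forall_inP=> x; rewrite inE => xS; apply/forall_inP=> y; rewrite inE => yS.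
  have /forall_inP/(_ _ xS)/forall_inP/(_ _ yS)/connectP[p path_p Dy] := conS.
  apply/connectP; exists (map (@flip r c) p).
    rewrite -[x](@flipK c r) path_map.
    by apply: sub_path path_p => u v /=; rewrite !inE !flipK adjacent_flip.
  by rewrite -[x](@flipK c r) last_map -Dy flipK.
apply: contra no_sq => /existsP[x /existsP[y /and5P[y1 y2 xS xyS /andP[yxS yS]]]].
rewrite !inE in xS xyS yxS yS.
apply/existsP; exists (flip x); apply/existsP; exists (flip y).
by rewrite /= y1 y2 xS yS xyS yxS.
Qed.

Lemma flip_BSD r c k (P : {set {set box r c}}) : P \in BSD r c k ->
  [set flip_set S | S in P] \in BSD c r k.
Proof.
rewrite !inE => /andP[/and3P[/eqP covP /trivIsetP tiP P0] /forall_inP stripP].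
apply/andP; split; last first.
  apply/forall_inP=> _ /imsetP[S SP ->]; have /andP[strS cS] := stripP S SP.
  by rewrite flip_border_strip // card_flip_set.
apply/and3P; split.
- apply/eqP/setP=> x; rewrite inE; apply/bigcupP.
  have : flip x \in cover P by rewrite covP inE.
  case/bigcupP=> S SP xS; exists (flip_set S); last by rewrite inE.
  exact: imset_f.
- apply/trivIsetP=> _ _ /imsetP[S1 S1P ->] /imsetP[S2 S2P ->] neq.
  have neq12 : S1 != S2 by apply: contraNneq neq => ->.
  have := tiP S1 S2 S1P S2P neq12; rewrite -!setI_eq0 => /eqP dis.
  by apply/eqP/setP=> x; rewrite !inE; have /setP/(_ (flip x)) := dis; rewrite !inE.
apply: contra P0 => /imsetP[S SP eq0].
by rewrite (_ : set0 = S) // -[S](@flip_setK r c) -eq0; apply/setP=> x; rewrite !inE.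
Qed.

Lemma card_BSD_flip r c k : #|BSD r c k| = #|BSD c r k|.
Proof.
suff le_card r1 c1 : #|BSD r1 c1 k| <= #|BSD c1 r1 k|.
  by apply/anti_leq; rewrite !le_card.
have flip_inj : injective (fun P : {set {set box r1 c1}} => [set flip_set S | S in P]).
  by apply: imset_inj; apply: can_inj (@flip_setK r1 c1).
rewrite -(card_imset _ flip_inj); apply: subset_leq_card.
by apply/subsetP=> _ /imsetP[P P_BSD ->]; apply: flip_BSD.
Qed.

End Transposition.

Theorem mainTheorem2 (v a : nat -> rat)
  (hv3 : v 3%N = 1)
  (hv : forall m : nat, (4 <= m)%N ->
     v m = 1 / 2%:R *
       \sum_(1 <= i < (m - 2)%N)
          (i * (m - i - 2))%N%:R / (m - 1)%N%:R
          * 'C(m - 4, i - 1)%:R * 'C(m, i + 1)%:R * v (i + 2)%N * v (m - i)%N)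
  (ha0 : a 0%N = 1)
  (ha : forall n : nat, (1 <= n)%N ->
     a n = 1 / 2%:R *
       \sum_(1 <= i < n.+1)
          (i * (n - i + 1))%N%:R / (n + 2)%N%:R
          * 'C(n - 1, i - 1)%:R * 'C(n + 3, i + 1)%:R * a (i - 1)%N * a (n - i)%N) :
  forall n : nat, (1 <= n)%N ->
    [/\ a n = v (n + 3)%N,
        v (n + 3)%N = #|BSD n (2 * n) n|%:R
      & #|BSD n (2 * n) n| = #|BSD (2 * n) n n|].
Proof.
(* With m = n + 3 the two recursions agree term by term. *)
have av n : a n = v (n + 3)%N.
  have [m] := ubnP n; elim: m n => // m IHm [|n] lt_m; first by rewrite ha0 hv3.
  rewrite ha // hv; last by lia.
  have -> : (n.+1 + 3 - 2 = n.+2)%N by lia.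
  congr (_ * _); rewrite big_nat_cond [RHS]big_nat_cond; apply: eq_bigr => i.
  case/andP=> /andP[i_gt0 lt_i] _; rewrite !IHm; try lia.
  have -> : (n.+1 + 3 - i - 2 = n.+1 - i + 1)%N by lia.
  have -> : (n.+1 + 3 - 1 = n.+1 + 2)%N by lia.
  have -> : (n.+1 + 3 - 4 = n.+1 - 1)%N by lia.
  have -> : (i - 1 + 3 = i + 2)%N by lia.
  by have -> : (n.+1 + 3 - i = n.+1 - i + 3)%N by lia.
move=> n n_gt0; split=> //; last exact: card_BSD_flip.
by rewrite -av card_BSD_codes // (size_codes_wp n_gt0 ha0 ha).
Qed.
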